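(* Let $\Gamma$ be a finitely generated group. If $\Gamma$ is not $SS$-rigid, then there exists a linear function $f(t) = at + b$ with $a > 0$ such that $$\varkappa(\Gamma, n) := \dim X_n(\Gamma) \geq f(n)$$ for all $n \geq 1$.
   Context: Fix an algebraically closed field $K$ of characteristic $0$. For a finitely generated group $\Gamma$ and $n \ge 1$, the $n$-th representation variety $R_n(\Gamma)$ is the affine algebraic variety (not necessarily irreducible) over $K$ whose points are the representations $\rho\colon \Gamma \to GL_n(K)$; it is realized as a Zariski-closed subset of $GL_n(K)^{d}$ by sending $\rho$ to the tuple of images of a finite system of $d$ generators of $\Gamma$. The group $GL_n(K)$ acts on $R_n(\Gamma)$ by conjugation (the adjoint action), and the $n$-th character variety $X_n(\Gamma)$ is the corresponding categorical quotient, i.e. the affine variety with coordinate ring $K[R_n(\Gamma)]^{GL_n(K)}$. Its points are in bijection with the isomorphism classes of completely reducible representations $\Gamma \to GL_n(K)$. The group $\Gamma$ is called $SS$-rigid if $\dim X_n(\Gamma) = 0$ for all $n \ge 1$. *)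

(* Defs.v *)
From HB Require Import structures.
From mathcomp Require Import all_boot all_order all_algebra.
From mathcomp Require Import boolp classical_sets functions reals
  constructive_ereal ereal.

Set Implicit Arguments.
Unset Strict Implicit.
Unset Printing Implicit Defensive.

Import Order.TTheory GRing.Theory Num.Theory.

Local Open Scope classical_set_scope.
Local Open Scope ring_scope.

(* A chain p 0 < p 1 < ... < p m of proper prime ideals; the values of p beyond
   m are irrelevant. *)
Definition prime_chain (A : comNzRingType) (m : nat) : Prop :=
  exists p : nat -> prime_idealr A, forall i, (i < m)%N ->
    {subset (p i : {pred A}) <= (p i.+1 : {pred A})} /\
    ~ {subset (p i.+1 : {pred A}) <= (p i : {pred A})}.

Definition krull_dim (R : realType) (A : comNzRingType) : \bar R :=
  ereal_sup [set m%:R%:E | m in [set m : nat | prime_chain A m]].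

Definition generates (Gamma : groupType) (d : nat) (gens : 'I_d -> Gamma) :
    Prop :=
  forall H : {pred Gamma}, group_closed H -> (forall i, gens i \in H) ->
    forall x, x \in H.

Section CharacterVariety.
Variables (K : closedFieldType) (Gamma : groupType).

Definition is_representation (n : nat) (rho : Gamma -> 'M[K]_n) : Prop :=
  [/\ forall x, rho x \in unitmx,
      rho 1%g = 1%:M &
      forall x y, rho (x * y)%g = rho x *m rho y].

Variables (d : nat) (gens : 'I_d -> Gamma) (n : nat).

Definition rep_variety : set ('I_d -> 'M[K]_n) :=
  [set x | exists2 rho : Gamma -> 'M[K]_n,
     is_representation rho & x = rho \o gens].

(* As K is algebraically closed, the coordinate ring of a Zariski-closed subset
   of GL_n(K)^d is the K-algebra of functions on its points generated by the
   restrictions of the matrix entries and of the inverse determinants. *)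
Inductive regular : (rep_variety -> K) -> Prop :=
| regular_cst (c : K) : regular (cst c)
| regular_entry (k : 'I_d) (i j : 'I_n) : regular (fun x => val x k i j)
| regular_invdet (k : 'I_d) : regular (fun x => (\det (val x k))^-1)
| regular_add f g : regular f -> regular g -> regular (f + g)
| regular_mul f g : regular f -> regular g -> regular (f * g).

Definition adjoint (g : 'M[K]_n) (x : 'I_d -> 'M[K]_n) : 'I_d -> 'M[K]_n :=
  fun k => g *m x k *m invmx g.

Lemma rep_variety_adjoint (g : 'M[K]_n) (x : 'I_d -> 'M[K]_n) :
  g \in unitmx -> rep_variety x -> rep_variety (adjoint g x).
Proof.
move=> gU [rho [rhoU rho1 rhoM] ->].
exists (fun y => g *m rho y *m invmx g) => //; split => [y||y z].
- by rewrite !unitmx_mul gU rhoU unitmx_inv gU.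
- by rewrite rho1 mulmx1 mulmxV.
- by rewrite rhoM !mulmxA mulmxKV.
Qed.

Definition invariant (f : rep_variety -> K) : Prop :=
  forall (g : 'M[K]_n) (x y : rep_variety),
    g \in unitmx -> val y = adjoint g (val x) -> f y = f x.

Definition invariant_regular : {pred rep_variety -> K} :=
  fun f => `[< regular f /\ invariant f >].

Fact invariant_regular_subring : subring_closed invariant_regular.
Proof.
split=> [|f g /asboolP[fr fi] /asboolP[gr gi]|f g /asboolP[fr fi] /asboolP[gr gi]].
- by apply/asboolP; split; [exact: (regular_cst 1)|].
- apply/asboolP; split.
    have -> : f - g = f + cst (-1) * g.
      by apply/funext => x; rewrite !fctE mulN1r.
    by do 2?[apply: regular_add => //|apply: regular_mul => //]; exact: regular_cst.
  by move=> h x y hU e; rewrite !fctE (fi h x y) // (gi h x y).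
- apply/asboolP; split; first exact: regular_mul.
  by move=> h x y hU e; rewrite !fctE (fi h x y) // (gi h x y).
Qed.

HB.instance Definition _ :=
  GRing.isSubringClosed.Build (rep_variety -> K) invariant_regular
    invariant_regular_subring.

(* The ring K[R_n(Gamma)]^(GL_n(K)), i.e. the coordinate ring of X_n(Gamma). *)
Record char_ring : Type := CharRing {
  char_fun :> rep_variety -> K;
  _ : char_fun \in invariant_regular }.

HB.instance Definition _ := [isSub for char_fun].
HB.instance Definition _ := [Choice of char_ring by <:].
HB.instance Definition _ :=
  GRing.SubChoice_isSubComPzRing.Build (rep_variety -> K) invariant_regular
    char_ring invariant_regular_subring.

Fact char_ring_neq0 : (1 : char_ring) != 0.
Proof.
have R1 : rep_variety ((fun=> 1%:M) \o gens).
  exists (fun=> 1%:M) => //.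
  by split=> *; rewrite ?unitmx1 ?mulmx1.
apply/eqP => /(congr1 (fun f : char_ring => f (SigSub (mem_set R1)))) /eqP.
by rewrite /= oner_eq0.
Qed.

HB.instance Definition _ :=
  GRing.PzSemiRing_isNonZero.Build char_ring char_ring_neq0.

End CharacterVariety.

(* The number dim X_n(Gamma). Another finite generating system gives an
   isomorphic coordinate ring, so this and [SS_rigid] depend on Gamma only. *)
Definition char_dim (R : realType) (K : closedFieldType) (Gamma : groupType)
    (d : nat) (gens : 'I_d -> Gamma) (n : nat) : \bar R :=
  krull_dim R (char_ring K gens n).

Definition SS_rigid (R : realType) (K : closedFieldType) (Gamma : groupType)
    (d : nat) (gens : 'I_d -> Gamma) : Prop :=
  forall n : nat, (0 < n)%N -> char_dim R K gens n = 0%E.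

(* Main.v *)
From HB Require Import structures.
Require Import Defs.
From mathcomp Require Import all_boot all_order all_algebra ring.
From mathcomp Require Import boolp classical_sets functions filter.
From mathcomp Require Import reals constructive_ereal ereal.

(* If Gamma is not SS-rigid, some invariant function f on R_m(Gamma) takes
   infinitely many values. By Hilbert's basis theorem it is not constant on some
   irreducible subset Z of R_m(Gamma). Two representations with the same traces
   have isomorphic semisimplifications, and a representation degenerates to its
   semisimplification inside the closure of its orbit, so f is a function of the
   traces. Hence some element a of the free algebra has a nonconstant
   characteristic polynomial on Z; after a translation of a by a scalar, its order
   of vanishing at 0 is e on a generic point of Z and larger at some z0 in Z.

   For n = k m + r let Y_i be the set of the representations
   z0 + ... + z0 (i times) + z_(i+1) + ... + z_k + (trivial of degree r), z_j in Z.
   The Y_i are irreducible and decreasing, and the order of vanishing at 0 of the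
   characteristic polynomial of a is generically strictly larger on Y_(i+1) than
   on Y_i. So the corresponding coefficient of that polynomial separates the
   prime ideals of Y_i and Y_(i+1), and dim X_n(Gamma) >= k. *)

Set Implicit Arguments.
Unset Strict Implicit.
Unset Printing Implicit Defensive.

Import Order.TTheory GRing.Theory Num.Theory.

Local Open Scope ring_scope.

(** * Hilbert's basis theorem *)

Section Noetherian.

Definition ideal_prop (A : comNzRingType) (I : A -> Prop) : Prop :=
  [/\ I 0, forall a b, I a -> I b -> I (a + b) & forall a b, I b -> I (a * b)].

(** Finite generation is phrased by minimality, each ideal [J] containing the list [l] having to
    contain [I], so that no linear combination is written out. *)
Definition noetherian (A : comNzRingType) : Prop :=
  forall I : A -> Prop, ideal_prop I ->
  exists2 l : seq A, {in l, forall a, I a} &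
    forall J : A -> Prop, ideal_prop J -> {in l, forall a, J a} ->
      forall a, I a -> J a.

Lemma ideal_propB (A : comNzRingType) (I : A -> Prop) a b :
  ideal_prop I -> I a -> I b -> I (a - b).
Proof. by case=> _ ID IM Ia Ib; apply: ID => //; rewrite -mulN1r; apply: IM. Qed.

Lemma noetherian_field (F : fieldType) : noetherian F.
Proof.
move=> I [I0 _ IM]; have [[a [Ia a0]]|nI] := pselect (exists a, I a /\ a != 0).
  exists [:: a] => [b|J [_ _ JM] Jl b _]; first by rewrite inE => /eqP ->.
  by rewrite -(divfK a0 b); apply: JM; apply: Jl; rewrite mem_head.
exists [::] => // J [J0 _ _] _ a Ia.
have [-> //|a0] := eqVneq a 0.
by case: nI; exists a.
Qed.

Lemma fin_choice_seq (T U : eqType) (l : seq T) (P : U -> Prop) (Q : T -> U -> Prop) :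
  {in l, forall a, exists2 u, P u & Q a u} ->
  exists2 s : seq U, {in s, forall u, P u} &
    {in l, forall a, exists2 u, u \in s & Q a u}.
Proof.
elim: l => [|a l IH] H; first by exists [::].
have [u Pu Qu] := H a (mem_head _ _).
have [b lb|s Ps Qs] := IH; first by apply: H; rewrite inE lb orbT.
exists (u :: s) => [v|b]; rewrite inE => /predU1P[->//|]; first exact: Ps.
  by exists u; rewrite ?mem_head.
by move=> /Qs[v sv Qv]; exists v; rewrite // inE sv orbT.
Qed.

Section Hilbert.
Variables (A : comNzRingType) (I : {poly A} -> Prop).
Hypotheses (nA : noetherian A) (idI : ideal_prop I).

Let coefI (m : nat) (a : A) : Prop :=
  exists2 p, I p /\ (size p <= m.+1)%N & p`_m = a.

Lemma coefI_ideal (J : {poly A} -> Prop) m : ideal_prop J ->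
  ideal_prop (fun a => exists2 p, J p /\ (size p <= m.+1)%N & p`_m = a).
Proof.
move=> [J0 JD JM]; split=> [|a b [p [Jp sp] <-] [q [Jq sq] <-]|a b [p [Jp sp] <-]].
- by exists 0; rewrite ?coef0 ?size_poly0.
- exists (p + q); rewrite ?coefD //; split; first exact: JD.
  by rewrite (leq_trans (size_polyD _ _)) // geq_max sp.
- exists (a *: p); rewrite ?coefZ //; split; last exact: leq_trans (size_scale_leq _ _) sp.
  by rewrite -mul_polyC; apply: JM.
Qed.

Let gens_at (s : seq {poly A}) (p : {poly A}) : Prop :=
  forall J : {poly A} -> Prop, ideal_prop J -> {in s, forall q, J q} -> J p.

Lemma gens_at_ideal s : ideal_prop (gens_at s).
Proof.
split=> [J [] //|p q gp gq J idJ Js|p q gq J idJ Js].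
  by case: (idJ) => _ JD _; apply: JD; [exact: gp | exact: gq].
by case: (idJ) => _ _ JM; apply: JM; exact: gq.
Qed.

Lemma gens_at_mem s p : p \in s -> gens_at s p.
Proof. by move=> sp J _; apply. Qed.

Lemma gens_at_sub s t p : {subset s <= t} -> gens_at s p -> gens_at t p.
Proof. by move=> st gp J idJ Jt; apply: gp => // q /st; exact: Jt. Qed.

(** Induction on the size bound: generators of the ideal of coefficients of index [M] lift to [t].
    Some [q] in the ideal of [s ++ t] then has the same top coefficient as [p], and [p - q] obeys
    the smaller bound. *)
Lemma hilbert_small M : exists2 s : seq {poly A}, {in s, forall p, I p} &
  forall p, I p -> (size p <= M)%N -> gens_at s p.
Proof.
elim: M => [|M [s Is sP]].
  exists [::] => // p _; rewrite leqn0 size_poly_eq0 => /eqP -> J [] //.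
have [l lI lP] := nA (coefI_ideal M idI).
have [a la|t It tP] := @fin_choice_seq _ _ l I
    (fun a p => (size p <= M.+1)%N /\ p`_M = a).
  by have [p [Ip sp] pa] := lI a la; exists p.
exists (s ++ t) => [p|p Ip sp].
  by rewrite mem_cat => /orP[/Is|/It].
have [||q [gq sq] qp] := lP _ (coefI_ideal M (gens_at_ideal (s ++ t))) _ p`_M.
- move=> a /tP[q tq [sq qa]]; exists q => //; split => //.
  by apply: gens_at_mem; rewrite mem_cat tq orbT.
- by exists p.
have idG := gens_at_ideal (s ++ t).
have -> : p = (p - q) + q by rewrite subrK.
case: (idG) => _ GD _; apply: (GD _ _ _ gq).
apply: (@gens_at_sub s) => [r rs|]; first by rewrite mem_cat rs.
apply: sP.
  apply: ideal_propB => //; apply: gq => // r.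
  by rewrite mem_cat => /orP[/Is|/It].
apply/leq_sizeP => j; rewrite leq_eqVlt => /predU1P[<-|Mj].
  by rewrite coefB qp subrr.
have z (r : {poly A}) : (size r <= M.+1)%N -> r`_j = 0.
  by move=> sr; rewrite nth_default // (leq_trans sr).
by rewrite coefB !z // subrr.
Qed.

(** The leading coefficients of all degrees form one ideal, whose generators lift to polynomials [t]
    of size at most [M]. Beyond size [M] the leading term of [p] is cancelled by multiples of
    members of [t]; up to size [M], [hilbert_small] applies. *)
Lemma hilbert_ideal : exists2 s : seq {poly A}, {in s, forall p, I p} &
  forall p, I p -> gens_at s p.
Proof.
have idL : ideal_prop (fun a => exists m, coefI m a).
  case: (idI) => I0 ID IM; split=> [|a b [m [p [Ip sp] pa]] [k [q [Iq sq] qb]]|a b [m cb]].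
  - by exists 0%N; case: (coefI_ideal 0 idI).
  (* A factor ['X^j] raises the degree without changing the leading coefficient, so two coefficients
     can be added in degree [m + k]. *)
  - have up i j c r : I r -> (size r <= i.+1)%N -> r`_i = c -> coefI (i + j)%N c.
      move=> Ir sr rc; exists ('X^j * r); last by rewrite coefXnM ltnNge leq_addl /= addnK.
      split; first exact: IM.
      have [->|r0] := eqVneq r 0; first by rewrite mulr0 size_poly0.
      by rewrite mulrC size_mulXn // addnC -addSn leq_add2r.
    exists (m + k)%N; case: (coefI_ideal (m + k) idI) => _ D _; apply: D.
      exact: up pa.
    by rewrite addnC; apply: up qb.
  - by exists m; case: (coefI_ideal m idI) => _ _; apply.
have [l lI lP] := nA idL.
have [a la|t It tP] := @fin_choice_seq _ _ l I
    (fun a p => exists2 m, (size p <= m.+1)%N & p`_m = a).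
  by have [m [p [Ip sp] pa]] := lI a la; exists p => //; exists m.
pose M := \max_(p <- t) size p.
have [s Is sP] := hilbert_small M.
have idG := gens_at_ideal (s ++ t).
exists (s ++ t) => [p|p]; first by rewrite mem_cat => /orP[/Is|/It].
have [n] := ubnP (size p); elim: n p => // n IHn p; rewrite ltnS => spn Ip.
have [spM|Msp] := leqP (size p) M.
  by apply: (@gens_at_sub s); [move=> r rs; rewrite mem_cat rs | exact: sP].
case En : (size p) => [|m]; first by rewrite En in Msp.
have [||q [gq sq] qp] := lP _ (coefI_ideal m idG) _ p`_m; last 1 first.
- have -> : p = (p - q) + q by rewrite subrK.
  case: (idG) => _ GD _; apply: (GD _ _ _ gq).
  apply: IHn; last first.
    by apply: ideal_propB => //; apply: gq => // r; rewrite mem_cat => /orP[/Is|/It].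
  apply: leq_trans spn; rewrite En ltnS; apply/leq_sizeP => j.
  rewrite leq_eqVlt => /predU1P[<-|mj]; first by rewrite coefB qp subrr.
  have z (r : {poly A}) : (size r <= m.+1)%N -> r`_j = 0.
    by move=> sr; rewrite nth_default // (leq_trans sr).
  by rewrite coefB !z ?En // subrr.
- move=> a /tP[q tq [k sq qa]].
  have [q0|q0] := eqVneq q 0.
    case: (coefI_ideal m idG) => G0 _ _.
    by move: qa; rewrite q0 coef0 => <-.
  have [az|a0] := eqVneq a 0.
    by case: (coefI_ideal m idG) => G0 _ _; rewrite az.
  have sqM : (size q <= M)%N by rewrite /M; apply: 
      (@leq_bigmax_seq _ _ xpredT (fun p : {poly A} => size p)).
  have km : (k <= m)%N.
    rewrite -ltnS -En; apply: leq_trans (leq_trans sqM (ltnW Msp)).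
    by rewrite ltnNge; apply: contra a0 => qk; rewrite -qa nth_default.
  exists ('X^(m - k) * q); last first.
    by rewrite coefXnM ltnNge leq_subr /= subKn.
  split; first by case: (idG) => _ _; apply; apply: gens_at_mem; rewrite mem_cat tq orbT.
  rewrite mulrC size_mulXn // (leq_trans (leq_add (leqnn _) sq)) //.
  by rewrite addnS subnK.
- by exists m; exists p; rewrite // En.
Qed.

End Hilbert.

Lemma noetherian_poly (A : comNzRingType) : noetherian A -> noetherian {poly A}.
Proof.
move=> nA I idI; have [s Is sP] := hilbert_ideal nA idI.
by exists s => // J idJ Js p Ip; exact: sP.
Qed.

(* A is a polynomial ring over F with one variable for each i in s, and phi x is
   its evaluation at the values t i x. *)
Lemma noetherian_cover (F : fieldType) (T : Type) (I : eqType) (t : I -> T -> F)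
    (s : seq I) :
  exists (A : comNzRingType) (phi : T -> {rmorphism A -> F}), [/\ noetherian A,
    forall c, exists a, forall x, phi x a = c &
    {in s, forall i, exists a, forall x, phi x a = t i x}].
Proof.
elim: s => [|i s [A [phi [nA cst tsP]]]].
  exists F, (fun=> idfun); split => //; first exact: noetherian_field.
  by move=> c; exists c.
exists {poly A}, (fun x => horner_eval (t i x) \o map_poly (phi x)).
split; first exact: noetherian_poly.
  move=> c; have [a aP] := cst c; exists a%:P => x /=.
  by rewrite /horner_eval map_polyC hornerC -(aP x).
move=> j; rewrite inE => /predU1P[->|/tsP[a aP]].
  by exists 'X => x; rewrite /= /horner_eval map_polyX hornerX.
by exists a%:P => x; rewrite /= /horner_eval map_polyC hornerC -(aP x).
Qed.

End Noetherian.

(** * Linear algebra *)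

Section LinearAlgebra.
Variable F : fieldType.

Lemma subspace_mx n (S : 'rV[F]_n -> Prop) :
  S 0 -> (forall c u v, S u -> S v -> S (c *: u + v)) ->
  exists W : 'M[F]_n, forall v, (v <= W)%MS <-> S v.
Proof.
move=> S0 SD.
pose P (m : nat) := exists2 W : 'M[F]_n, \rank W = m & forall v, (v <= W)%MS -> S v.
have P0 : exists m, `[< P m >].
  exists 0%N; apply/asboolP; exists 0; first by rewrite mxrank0.
  by move=> v; rewrite submx0 => /eqP ->.
have Pn m : `[< P m >] -> (m <= n)%N by move=> /asboolP[W <- _]; exact: rank_leq_row.
case: (ex_maxnP P0 Pn) => m /asboolP[W Wm WS] mmax.
exists W => v; split=> [/WS//|Sv].
have Q : P (\rank (W + v)%MS).
  exists (W + v)%MS => // w /sub_addsmxP[[u1 u2] -> /=].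
  have -> : u2 *m v = (u2 0 0) *: v by rewrite {1}[u2]mx11_scalar mul_scalar_mx.
  by rewrite addrC; apply: SD => //; apply: WS; exact: submxMl.
apply: contraT => vW; have := mmax _ (introT (asboolP _) Q).
rewrite leqNgt -Wm rank_ltmx // /ltmx addsmxSl /=.
by apply: contra vW => /(submx_trans (addsmxSr W v)).
Qed.

(** Fitting's lemma: a Bezout relation between a power of ['X] and the part [r] of [char_poly C]
    prime to ['X] gives the projection onto the part where [C] is invertible. The shape ['X * q]
    keeps it in every corner that contains [C]. *)
Lemma fitting_poly n (C : 'M[F]_n.+1) : exists q k,
  [/\ horner_mx C ('X * q) *m horner_mx C ('X * q) = horner_mx C ('X * q) &
      horner_mx C ('X^k) *m horner_mx C ('X * q) = horner_mx C ('X^k)].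
Proof.
have [j [r]] := multiplicity_XsubC (char_poly C) 0.
have p0 : char_poly C != 0 by rewrite -size_poly_eq0 size_char_poly.
rewrite p0 subr0 /= => r0 pE.
(* The exponent [j.+1] makes the projection divisible by ['X] even if [j = 0]. *)
have cop : coprimep 'X^(j.+1) r.
  by rewrite coprimep_sym coprimep_expr // coprimepX.
have [u [v uv]] : exists u v : {poly F}, u * 'X^(j.+1) + v * r = 1.
  by have /Bezout_eq1_coprimepP[[u v] /= uv] := cop; exists u, v.
have z w : horner_mx C (w * (r * 'X^(j.+1))) = 0.
  have -> : w * (r * 'X^(j.+1)) = w * 'X * char_poly C by rewrite pE exprS; ring.
  by rewrite rmorphM /= Cayley_Hamilton mulr0.
have fE : 'X * (u * 'X^j) = 1 - v * r by rewrite -uv addrK exprS mulrCA.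
exists (u * 'X^j), j.+1; split; rewrite mulmxE -rmorphM /=.
  rewrite [X in horner_mx C (_ * X)]fE mulrBr mulr1 rmorphB /=.
  have -> : 'X * (u * 'X^j) * (v * r) = (u * v) * (r * 'X^(j.+1)).
    by rewrite exprS; ring.
  by rewrite z subr0.
rewrite fE mulrBr mulr1 rmorphB /=.
have -> : 'X^(j.+1) * (v * r) = v * (r * 'X^(j.+1)) by ring.
by rewrite z subr0.
Qed.

(** In the rank factorization [E = C *m R], idempotence forces [R *m C = 1]; the trace is cyclic. *)
Lemma idempotent_trace n (E : 'M[F]_n) : E *m E = E -> \tr E = (\rank E)%:R.
Proof.
move=> EE.
have h : row_base E *m col_base E = 1%:M.
  set R := row_base E; set C := col_base E.
  have CR : C *m R = E := mulmx_base E.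
  have h1 : C *m R *m C = C.
    by apply: (row_free_inj (row_base_free E)); rewrite -mulmxA CR EE.
  have cf : row_free C^T by rewrite /row_free mxrank_tr -/(row_full _) col_base_full.
  apply: trmx_inj; apply: (row_free_inj cf).
  by rewrite -!trmx_mul mulmxA h1 mulmx1.
by rewrite -{1}(mulmx_base E) mxtrace_mulC h mxtrace1.
Qed.

Lemma invertible_dim m n (P : 'M[F]_(m, n)) Q : P *m Q = 1%:M -> Q *m P = 1%:M -> m = n.
Proof. by move=> /mulmx1_min h1 /mulmx1_min h2; apply/eqP; rewrite eqn_leq h1 h2. Qed.

End LinearAlgebra.

(** * Tuples of matrices as modules over the free algebra *)

Section FreeAlgebra.
Variables (K : closedFieldType) (d : nat).

Local Notation tup n := ('I_d -> 'M[K]_n).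

(** Noncommutative polynomials in [d] letters as plain syntax; two of them are compared only through
    their evaluations. *)
Inductive falg : Type :=
| FCst (c : K) | FGen (k : 'I_d) | FAdd (a b : falg) | FMul (a b : falg).

Fixpoint feval n (x : tup n) (a : falg) : 'M[K]_n :=
  match a with
  | FCst c => c%:M
  | FGen k => x k
  | FAdd a b => feval x a + feval x b
  | FMul a b => feval x a *m feval x b
  end.

Definition fpow (a : falg) (k : nat) : falg := iter k (FMul a) (FCst 1).
Definition fsub (a b : falg) : falg := FAdd a (FMul (FCst (-1)) b).
Definition fcomb m (c : 'I_m -> K) (b : 'I_m -> falg) : falg :=
  \big[FAdd/FCst 0]_(i < m) FMul (FCst (c i)) (b i).

Lemma feval_sub n (x : tup n) a b : feval x (fsub a b) = feval x a - feval x b.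
Proof. by rewrite /= mul_scalar_mx scaleN1r. Qed.

Lemma feval_comb n (x : tup n) m (c : 'I_m -> K) b :
  feval x (fcomb c b) = \sum_(i < m) c i *: feval x (b i).
Proof.
rewrite /fcomb (big_morph (feval x) (id1 := 0) (op1 := +%R)) //=; last by rewrite raddf0.
by apply: eq_bigr => i _; rewrite mul_scalar_mx.
Qed.

Lemma feval_powS n (x : tup n) a k :
  feval x (fpow a k.+1) = feval x a *m feval x (fpow a k).
Proof. by []. Qed.

Lemma feval_horner n (x : tup n.+1) a q :
  exists b, feval x b = horner_mx (feval x a) q.
Proof.
elim/poly_ind: q => [|q c [b bP]]; first by exists (FCst 0); rewrite rmorph0 /= raddf0.
exists (FAdd (FMul b a) (FCst c)).
by rewrite rmorphD rmorphM /= horner_mx_X horner_mx_C bP.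
Qed.

Lemma feval_pow n (x : tup n.+1) a k : feval x (fpow a k) = feval x a ^+ k.
Proof. by elim: k => //= k ->; rewrite exprS. Qed.

Lemma feval_intertwine n m (x : tup n) (y : tup m) (P : 'M_(n, m)) a :
  (forall k, x k *m P = P *m y k) -> feval x a *m P = P *m feval y a.
Proof.
move=> xP; elim: a => //= [c|a IHa b IHb|a IHa b IHb].
- by rewrite mul_scalar_mx mul_mx_scalar.
- by rewrite mulmxDl mulmxDr IHa IHb.
- by rewrite -mulmxA IHb !mulmxA IHa.
Qed.

(** Matrices act on row vectors from the right, so in this extension [x] is the submodule and [y]
    the quotient. *)
Definition ltri n m (x : tup n) (c : 'I_d -> 'M[K]_(m, n)) (y : tup m) : tup (n + m) :=
  fun k => block_mx (x k) 0 (c k) (y k).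
Definition dsum n m (x : tup n) (y : tup m) : tup (n + m) := ltri x (fun=> 0) y.

Lemma feval_ltri n m (x : tup n) c (y : tup m) a :
  exists C, feval (ltri x c y) a = block_mx (feval x a) 0 C (feval y a).
Proof.
elim: a => [e|k|a [A aE] b [B bE]|a [A aE] b [B bE]] /=.
- by exists 0; rewrite scalar_mx_block.
- by exists (c k).
- by exists (A + B); rewrite aE bE add_block_mx addr0.
- exists (A *m feval x b + feval y a *m B).
  by rewrite aE bE mulmx_block !mul0mx !mulmx0 !addr0 add0r.
Qed.

Lemma feval_dsum n m (x : tup n) (y : tup m) a :
  feval (dsum x y) a = block_mx (feval x a) 0 0 (feval y a).
Proof.
elim: a => [e|k|a aE b bE|a aE b bE] //=; first by rewrite scalar_mx_block.
  by rewrite aE bE add_block_mx !addr0.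
by rewrite aE bE mulmx_block !mul0mx !mulmx0 !addr0 add0r.
Qed.

(** The sizes may differ syntactically, which spares casts; [P] and [Q] force them to be equal. *)
Definition tup_iso n m (x : tup n) (y : tup m) : Prop :=
  exists P Q, [/\ P *m Q = 1%:M, Q *m P = 1%:M & forall k, x k *m P = P *m y k].

Lemma tup_iso_trace n m (x : tup n) (y : tup m) a : tup_iso x y ->
  \tr (feval x a) = \tr (feval y a).
Proof.
move=> [P [Q [PQ QP xP]]]; rewrite -[feval x a]mulmx1 -PQ mulmxA.
by rewrite (feval_intertwine _ xP) mxtrace_mulC mulmxA QP mul1mx.
Qed.

Lemma tup_iso_eval0 n m (x : tup n) (y : tup m) a : tup_iso x y ->
  feval x a = 0 -> feval y a = 0.
Proof.
move=> [P [Q [PQ QP xP]]] xa; rewrite -[feval y a]mul1mx -QP -mulmxA.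
by rewrite -(feval_intertwine _ xP) xa mul0mx mulmx0.
Qed.

Lemma tup_iso_dsumCA n m p (x : tup n) (y : tup m) (z : tup p) :
  tup_iso (dsum x (dsum y z)) (dsum y (dsum x z)).
Proof.
exists (block_mx 0 (row_mx 1%:M 0) (col_mx 1%:M 0) (block_mx 0 0 0 1%:M)).
exists (block_mx 0 (row_mx 1%:M 0) (col_mx 1%:M 0) (block_mx 0 0 0 1%:M)).
have inv (i j : nat) : block_mx 0 (row_mx 1%:M 0) (col_mx 1%:M 0) (block_mx 0 0 0 1%:M) *m
  block_mx 0 (row_mx 1%:M 0) (col_mx 1%:M 0) (block_mx 0 0 0 1%:M) = 1%:M
  :> 'M[K]_(i + (j + p)).
  rewrite mulmx_block !mul0mx !mulmx0 !add0r mul_col_row mul_row_col mul_row_block.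
  rewrite mul_block_col !mulmx_block add_block_mx !(mul1mx, mulmx0, mul0mx, addr0, add0r).
  by rewrite row_mx0 col_mx0 -!scalar_mx_block.
split=> [||k]; [exact: inv|exact: inv|].
rewrite /dsum /ltri !mulmx_block !mul0mx !mulmx0 !addr0 !add0r.
rewrite mul_mx_row mul_row_block mul_block_col mul_col_mx.
by rewrite !(mul0mx, mulmx0, mul1mx, mulmx1, addr0, add0r).
Qed.

Definition irred n (x : tup n) : Prop :=
  (0 < n)%N /\ forall u : 'rV[K]_n, u != 0 -> forall v, exists a, u *m feval x a = v.

Lemma orbit_mx n (x : tup n) (u : 'rV[K]_n) :
  exists W : 'M[K]_n, forall v, (v <= W)%MS <-> exists a, u *m feval x a = v.
Proof.
apply: subspace_mx => [|c v w [a <-] [b <-]].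
  by exists (FCst 0); rewrite /= raddf0 mulmx0.
exists (FAdd (FMul (FCst c) a) b) => /=.
by rewrite mulmxDr mul_scalar_mx -scalemxAr.
Qed.

(** In a basis [G] of [W] completed by a complement, the rows coming from [W] are sent into [W], so
    the upper right block vanishes. *)
Lemma base_change_stable n (x : tup n) (W : 'M[K]_n) :
  (forall k, (W *m x k <= W)%MS) ->
  exists p (c : 'I_d -> 'M[K]_(p, \rank W)) (y : tup p),
    tup_iso x (ltri (fun k => row_base W *m x k *m pinvmx (row_base W)) c y).
Proof.
move=> Wx.
pose G := col_mx (row_base W) (row_base W^C%MS).
have Gfull : row_full G.
  rewrite -sub1mx (submx_trans _ (_ : W + W^C <= _)%MS) ?sub1mx ?addsmx_compl_full //.
  by rewrite -addsmxE addsmxS ?eq_row_base.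
have eN : (\rank W + \rank W^C)%N = n by rewrite mxrank_compl subnKC ?rank_leq_row.
have Gfree : row_free G by rewrite /row_free (eqP Gfull) eN.
have [H [GH HG]] : exists H, G *m H = 1%:M /\ H *m G = 1%:M.
  exists (pinvmx G); split; first by rewrite mulmxVp.
  by rewrite -[_ *m G]mul1mx mulmxA mulmxKpV // sub1mx.
pose z k := G *m x k *m H.
exists (\rank W^C%MS), (fun k => dlsubmx (z k)), (fun k => drsubmx (z k)), H, G.
split => // k.
have -> : x k *m H = H *m z k by rewrite /z !mulmxA HG mul1mx.
congr (_ *m _); rewrite -[LHS]submxK /ltri.
have zu : usubmx (z k) = row_mx (row_base W *m x k *m pinvmx (row_base W)) 0.
  have -> : usubmx (z k) = row_base W *m x k *m H.
    by rewrite /z -mulmxA -[G]vsubmxK mul_col_mx col_mxKu /G col_mxKu mulmxA.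
  have RH : row_base W *m H = row_mx 1%:M 0.
    by move: GH; rewrite /G mul_col_mx scalar_mx_block block_mxEv => /eq_col_mx[].
  have {1}<- : row_base W *m x k *m pinvmx (row_base W) *m row_base W = row_base W *m x k.
    rewrite mulmxKpV //; have /submxP[D DE] : (row_base W <= W)%MS by rewrite eq_row_base.
    by rewrite eq_row_base DE -mulmxA (submx_trans (submxMl _ _)).
  by rewrite -[LHS]mulmxA RH mul_mx_row mulmx0 mulmx1.
congr block_mx; first by rewrite /ulsubmx zu row_mxKl.
by rewrite /ursubmx zu row_mxKr.
Qed.

(** A cyclic submodule of minimal dimension among those of nonzero vectors is simple: each of its
    nonzero vectors generates a submodule that cannot be smaller. *)
Lemma irred_sub n (x : tup n) : (0 < n)%N ->
  exists m p (s : tup m) (c : 'I_d -> 'M_(p, m)) (t : tup p),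
    irred s /\ tup_iso x (ltri s c t).
Proof.
move=> n0.
pose S (u : 'rV[K]_n) (W : 'M[K]_n) :=
  u != 0 /\ forall v, (v <= W)%MS <-> exists a, u *m feval x a = v.
have [m [[u [W [[u0 WP] rW]]] mmin]] : exists m, (exists u W, S u W /\ \rank W = m) /\
    forall u W, S u W -> (m <= \rank W)%N.
  have ex : exists m, `[< exists u W, S u W /\ \rank W = m >].
    have [W WP] := orbit_mx x (const_mx 1 : 'rV[K]_n).
    exists (\rank W); apply/asboolP; exists (const_mx 1), W; split=> //; split=> //.
    apply/eqP => /matrixP/(_ 0 (Ordinal n0)); rewrite !mxE => /eqP.
    by rewrite oner_eq0.
  case: (ex_minnP ex) => m /asboolP mP mmin; exists m; split=> // u W uW.
  by apply: mmin; apply/asboolP; exists u, W.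
have uW : (u <= W)%MS by apply/WP; exists (FCst 1); rewrite /= mulmx1.
have Wstab a : (W *m feval x a <= W)%MS.
  apply/row_subP => i; rewrite row_mul.
  have /WP[b bE] := row_sub i W.
  by apply/WP; exists (FMul b a); rewrite /= mulmxA bE.
have [p [c [t iso]]] := base_change_stable (fun k => Wstab (FGen k)).
pose s : tup (\rank W) := fun k => row_base W *m x k *m pinvmx (row_base W).
exists (\rank W), p, s, c, t; split=> //; split.
  by rewrite lt0n mxrank_eq0; apply: contraNneq u0 => W0; move: uW; rewrite W0 submx0.
have sx a : feval s a *m row_base W = row_base W *m feval x a.
  apply: feval_intertwine => k; rewrite /s mulmxKpV //.
  have /submxP[D DE] : (row_base W <= W)%MS by rewrite eq_row_base.
  by rewrite eq_row_base DE -mulmxA (submx_trans (submxMl _ _)) // (Wstab (FGen k)).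
move=> v v0 w; pose v' := v *m row_base W.
have v'0 : v' != 0.
  apply: contraNneq v0 => v'0; apply/eqP.
  by apply: (row_free_inj (row_base_free W)); rewrite mul0mx.
have v'W : (v' <= W)%MS by rewrite (submx_trans (submxMl _ _)) // eq_row_base.
have [W' W'P] := orbit_mx x v'.
have W'W : (W' <= W)%MS.
  apply/row_subP => i; have /W'P[a <-] := row_sub i W'.
  by apply: submx_trans (Wstab a); apply: submxMr.
have : (W <= W')%MS by rewrite -(mxrank_leqif_sup W'W) eqn_leq mxrankS // rW (mmin v' W').
have wW : (w *m row_base W <= W)%MS by rewrite (submx_trans (submxMl _ _)) // eq_row_base.
move=> /(submx_trans wW)/W'P[a aE]; exists a.
by apply: (row_free_inj (row_base_free W)); rewrite /= -aE /v' -[LHS]mulmxA sx mulmxA.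
Qed.

(* The corner e A e of a minimal idempotent e of the algebra A generated by z is
   local, with residue field K. *)
Lemma minimal_idempotent_corner n (z : tup n) (e b : falg) :
  feval z (FMul e e) = feval z e -> feval z e != 0 ->
  (forall a, feval z (FMul a a) = feval z a -> feval z a != 0 ->
    (\rank (feval z e) <= \rank (feval z a))%N) ->
  exists l k, feval z (fpow (fsub (FMul e (FMul b e)) (FMul (FCst l) e)) k) = 0.
Proof.
case: n z => [z _ e0 _|n z /= ee e0 emin].
  by move: e0; rewrite flatmx0 eqxx.
set E := feval z e in ee e0 emin *.
(* [M] is the matrix of [ebe] restricted to the row space of [E], in the basis [R]; [u] comes from
   one of its eigenvectors. *)
have [l [u [u0 uE uB]]] : exists l (u : 'rV_n.+1),
    [/\ u != 0, u *m E = u & u *m (E *m (feval z b *m E)) = l *: u].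
  pose R := row_base E; pose M := R *m (E *m (feval z b *m E)) *m pinvmx R.
  have [l lM] : exists l, root (char_poly M) l.
    apply: closed_rootP; rewrite size_char_poly eqSS -lt0n lt0n mxrank_eq0 //.
  rewrite -eigenvalue_root_char in lM; have /eigenvalueP[v vM v0] := lM.
  exists l, (v *m R); split.
  - apply: contraNneq v0 => vR; apply/eqP.
    by apply: (row_free_inj (row_base_free E)); rewrite vR mul0mx.
  - have /submxP[D DE] : (R <= E)%MS by rewrite eq_row_base.
    by rewrite DE -!mulmxA ee.
  - have ME : M *m R = R *m (E *m (feval z b *m E)).
      by rewrite mulmxKpV // eq_row_base !mulmxA submxMl.
    by rewrite scalemxAl -vM -[RHS]mulmxA ME -[LHS]mulmxA.
set B := FMul e (FMul b e) in uB *.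
exists l; set c := fsub B _; pose C := feval z c.
have CE : C = E *m (feval z b *m E) - l *: E by rewrite /C feval_sub /= mul_scalar_mx.
have uC : u *m C = 0 by rewrite CE mulmxBr uB -scalemxAr uE subrr.
have EC : E *m C = C.
  by rewrite CE mulmxBr (mulmxA E E) ee -scalemxAr ee.
have CEE : C *m E = C.
  by rewrite CE mulmxBl -!mulmxA ee -scalemxAl ee.
(* The Fitting idempotent [f] of [C] lies in the corner. Were it nonzero, minimality would give it
   the row space of [E], hence [u f = u]; but [f] is a multiple of [C], which kills [u]. So [f = 0]
   and [C] is nilpotent. *)
have [q [k [ff Ck]]] := fitting_poly C.
exists k; rewrite feval_pow -/C.
have [f fE] := feval_horner z c ('X * q); rewrite -/C in fE.
rewrite rmorphXn /= horner_mx_X -fE in Ck.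
rewrite -fE in ff.
have [f0|f0] := eqVneq (feval z f) 0; first by rewrite -Ck f0 mulmx0.
have := emin f ff f0.
have fq : feval z f = horner_mx C q *m C.
  by rewrite fE mulrC rmorphM /= horner_mx_X.
have fq' : feval z f = C *m horner_mx C q.
  by rewrite fE rmorphM /= horner_mx_X.
have fsubE : (feval z f <= E)%MS by rewrite fq -CEE mulmxA submxMl.
move=> rf; have : (E <= feval z f)%MS.
  by rewrite -(mxrank_leqif_sup fsubE) eqn_leq mxrankS.
have uEs : (u <= E)%MS by rewrite -uE submxMl.
move=> /(submx_trans uEs)/submxP[D DE].
move: u0; rewrite DE -ff mulmxA -DE fq' mulmxA uC mul0mx eqxx //.
Qed.

(** * Simple modules sharing a local corner *)

Section CommonConstituent.
Variables (e : falg) (lam : falg -> K) (nu : falg -> nat).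
(** Here [lam] stands for the residue map of the local corner of [e]; one pair [lam], [nu] serves
    both modules to be compared. *)
Let corner_nil b : falg :=
  fpow (fsub (FMul e (FMul b e)) (FMul (FCst (lam b)) e)) (nu b).

Section Corner.
Variables (n : nat) (x : tup n).
Hypotheses (irx : irred x) (ee : feval x (FMul e e) = feval x e)
  (ex : feval x e != 0) (nilx : forall b, feval x (corner_nil b) = 0).

Let E := feval x e.
Let EE : E *m E = E := ee.

(** On the eigenvector [u] the nilpotent [ebe - lam b e] acts as the number [l - lam b], which is
    then nilpotent. *)
Lemma corner_eigen b (u : 'rV_n) l : u != 0 -> u *m E = u ->
  u *m (E *m feval x b *m E) = l *: u -> l = lam b.
Proof.
move=> u0 uE uB; apply/eqP; rewrite -subr_eq0.
have uc : forall k, u *m feval x (fpow (fsub (FMul e (FMul b e)) (FMul (FCst (lam b)) e)) k)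
    = (l - lam b) ^+ k *: u.
  elim=> [|k IH]; first by rewrite /= mulmx1 scale1r.
  rewrite feval_powS mulmxA.
  rewrite feval_sub /= -/E mulmxBr !mulmxA mul_mx_scalar -!scalemxAl uE.
  have -> : u *m feval x b *m E = l *: u by rewrite -uB !mulmxA uE.
  by rewrite -scalerBl -scalemxAl IH scalerA exprS.
have := uc (nu b); rewrite nilx mulmx0 => /esym/eqP.
by rewrite scaler_eq0 (negPf u0) orbF expf_eq0 => /andP[].
Qed.

(** Simplicity improves nilpotence of [ebe - lam b e] to vanishing, so [lam] alone governs the row
    space of [E]. *)
Lemma corner_scalar b (u : 'rV_n) : u *m E = u ->
  u *m feval x b *m E = lam b *: u.
Proof.
move=> uE; pose c := fsub (FMul e (FMul b e)) (FMul (FCst (lam b)) e).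
have cE v : v *m E = v -> v *m feval x c = v *m feval x b *m E - lam b *: v.
  by move=> vE; rewrite /c feval_sub /= -/E mulmxBr !mulmxA mul_mx_scalar -!scalemxAl vE.
have cEE v : v *m E = v -> v *m feval x c *m E = v *m feval x c.
  by move=> vE; rewrite cE // mulmxBl -!mulmxA EE -scalemxAl vE.
(* If u c != 0, irreducibility sends u c back to u by some a, so that b' a has
   eigenvalue 1 on the corner; but c is nilpotent there, hence kills some vector. *)
have [[z [z0 zE zc]]|c0] := pselect (exists z : 'rV[K]_n,
    [/\ z != 0, z *m E = z & z *m feval x c = 0]);
  last first.
  (* Without such a [z], [c] and its powers are injective on the row space of [E]; nilpotence leaves
     only [u = 0]. *)
  have pw k (v : 'rV[K]_n) : v *m E = v -> v != 0 -> v *m feval x (fpow c k) != 0.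
    elim: k v => [|k IH] v vE v0; first by rewrite /= mulmx1.
    rewrite feval_powS mulmxA.
    apply: IH; first exact: cEE.
    by apply: contra_not_neq c0 => vc; exists v.
  have [->|u0] := eqVneq u 0; first by rewrite !mul0mx scaler0.
  by have := pw (nu b) u uE u0; rewrite nilx mulmx0 eqxx.
apply/eqP; rewrite -subr_eq0 -cE //; apply/negPn/negP => w0.
have u0 : u != 0 by apply: contraNneq w0 => ->; rewrite mul0mx.
have [a aP] := irx.2 _ w0 u.
have cd v : v *m E = v ->
    v *m (E *m feval x (FMul c a) *m E) = v *m feval x c *m feval x a *m E.
  by move=> vE; rewrite /= !mulmxA vE.
have l1 : 1 = lam (FMul c a).
  by apply: (corner_eigen u0 uE); rewrite cd // aP uE scale1r.
have l0 : 0 = lam (FMul c a).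
  by apply: (corner_eigen z0 zE); rewrite cd // zc !mul0mx scale0r.
by have := oner_neq0 K; rewrite l1 -l0 eqxx.
Qed.
Lemma corner_vector : exists2 u : 'rV[K]_n, u != 0 & u *m E = u.
Proof.
have [i Ei] : exists i, row i E != 0.
  apply: contra_notP (negP ex) => h; apply/eqP/row_matrixP => i; rewrite row0.
  by apply/eqP/negPn/negP => Ei; apply: h; exists i.
by exists (row i E) => //; rewrite -row_mul EE.
Qed.
End Corner.

(** The annihilator of [u] is determined by [lam]: [u b = 0] gives [lam (bc) = 0] for all [c], hence
    [v b c e = 0]. Were [v b] nonzero, the vectors [v b c] would fill the module and [e] would act
    as zero. *)
Lemma corner_annihilator n m (x : tup n) (y : tup m) (u : 'rV_n) (v : 'rV_m) b :
  irred x -> feval x (FMul e e) = feval x e -> (forall b, feval x (corner_nil b) = 0) ->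
  irred y -> feval y (FMul e e) = feval y e -> (forall b, feval y (corner_nil b) = 0) ->
  feval y e != 0 -> u != 0 -> u *m feval x e = u -> v *m feval y e = v ->
  u *m feval x b = 0 -> v *m feval y b = 0.
Proof.
move=> irx eex nx iry eey ny ey u0 uE vE ub; apply/eqP/negPn/negP => w0.
move: ey => /negP; apply; apply/eqP/row_matrixP => i; rewrite row0 rowE.
have [c <-] := iry.2 _ w0 (delta_mx 0 i).
have := corner_scalar irx eex nx (FMul b c) uE.
rewrite /= mulmxA ub !mul0mx => /esym/eqP; rewrite scaler_eq0 (negPf u0) orbF => /eqP l0.
by have := corner_scalar iry eey ny (FMul b c) vE; rewrite l0 scale0r /= !mulmxA.
Qed.

Lemma common_constituent_iso n m (x : tup n) (y : tup m) :
  irred x -> feval x (FMul e e) = feval x e -> (forall b, feval x (corner_nil b) = 0) ->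
  feval x e != 0 ->
  irred y -> feval y (FMul e e) = feval y e -> (forall b, feval y (corner_nil b) = 0) ->
  feval y e != 0 -> tup_iso x y.
Proof.
move=> irx eex nx ex iry eey ny ey.
have [u u0 uE] := corner_vector eex ex; have [v v0 vE] := corner_vector eey ey.
(* the isomorphism is u b |-> v b *)
have extend n1 m1 (x1 : tup n1) (y1 : tup m1) (u1 : 'rV_n1) (v1 : 'rV_m1) :
    irred x1 -> u1 != 0 -> (forall b, u1 *m feval x1 b = 0 -> v1 *m feval y1 b = 0) ->
    exists P, forall b, u1 *m feval x1 b *m P = v1 *m feval y1 b.
  move=> irx1 u10 ann.
  have /choice[b bP] i : exists b, u1 *m feval x1 b = delta_mx 0 i by exact: irx1.2.
  exists (\matrix_i (v1 *m feval y1 (b i))) => a.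
  pose r := u1 *m feval x1 a.
  (* Well-definedness: [a] and the combination of the [b i] agree on [u1], hence on [v1]. *)
  have := ann (fsub a (fcomb (fun i => r 0 i) b)).
  rewrite !feval_sub !feval_comb !mulmxBr !mulmx_sumr.
  under eq_bigr do rewrite -scalemxAr bP.
  rewrite -row_sum_delta subrr => /(_ erefl)/eqP; rewrite subr_eq0 => /eqP ->.
  by rewrite mulmx_sum_row; apply: eq_bigr => i _; rewrite rowK scalemxAr.
have [P PE] := extend _ _ x y u v irx u0
  (fun b => corner_annihilator irx eex nx iry eey ny ey u0 uE vE).
have [Q QE] := extend _ _ y x v u iry v0
  (fun b => corner_annihilator iry eey ny irx eex nx ex v0 vE uE).
exists P, Q; split.
- apply/row_matrixP => i; rewrite rowE row1; have [b <-] := irx.2 _ u0 (delta_mx 0 i).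
  by rewrite mulmxA PE QE.
- apply/row_matrixP => i; rewrite rowE row1; have [b <-] := iry.2 _ v0 (delta_mx 0 i).
  by rewrite mulmxA QE PE.
- move=> k; apply/row_matrixP => i; rewrite !row_mul !rowE.
  have [b <-] := irx.2 _ u0 (delta_mx 0 i).
  by rewrite PE -[u *m _ *m x k]mulmxA (PE (FMul b (FGen k))) -mulmxA.
Qed.
End CommonConstituent.
End FreeAlgebra.

(** * Regular functions *)

Section RegularFunctions.
Variables (K : closedFieldType) (d : nat).
Local Notation tup n := ('I_d -> 'M[K]_n).

(** Functions on all tuples, so that substitutions such as [dsum x y] carry no proof of being a
    representation. At a singular matrix the inverse determinant takes the default value 0. *)
Inductive regfun n : (tup n -> K) -> Prop :=
| regfun_cst (c : K) : regfun (fun=> c)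
| regfun_entry (k : 'I_d) (i j : 'I_n) : regfun (fun x => x k i j)
| regfun_invdet (k : 'I_d) : regfun (fun x => (\det (x k))^-1)
| regfun_add F G : regfun F -> regfun G -> regfun (fun x => F x + G x)
| regfun_mul F G : regfun F -> regfun G -> regfun (fun x => F x * G x).

Lemma regfun_sum n (I : Type) (r : seq I) (P : pred I) (F : I -> tup n -> K) :
  (forall i, regfun (F i)) -> regfun (fun x => \sum_(i <- r | P i) F i x).
Proof.
move=> HF; elim: r => [|i r IH].
  by under eq_fun do rewrite big_nil; exact: regfun_cst.
under eq_fun do rewrite big_cons.
by case: (P i) => //; exact: regfun_add.
Qed.

Lemma regfun_feval n (a : falg K d) i j : regfun (fun x : tup n => feval x a i j).
Proof.
elim: a i j => [c|k|a IHa b IHb|a IHa b IHb] i j /=.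
- exact: regfun_cst.
- exact: regfun_entry.
- by under eq_fun do rewrite mxE; exact: regfun_add.
- by under eq_fun do rewrite mxE; apply: regfun_sum => k; exact: regfun_mul.
Qed.

Definition regpoly n (p : tup n -> {poly K}) : Prop := forall m, regfun (fun x => (p x)`_m).

Lemma regpoly_add n (p q : tup n -> {poly K}) :
  regpoly p -> regpoly q -> regpoly (fun x => p x + q x).
Proof. by move=> hp hq m; under eq_fun do rewrite coefD; exact: regfun_add. Qed.

Lemma regpoly_mul n (p q : tup n -> {poly K}) :
  regpoly p -> regpoly q -> regpoly (fun x => p x * q x).
Proof.
move=> hp hq m; under eq_fun do rewrite coefM.
by apply: regfun_sum => k; exact: regfun_mul.
Qed.

Lemma regpoly_cst n (p : {poly K}) : regpoly (fun _ : tup n => p).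
Proof. by move=> m; exact: regfun_cst. Qed.

Lemma regfun_char_poly n (a : falg K d) m :
  regfun (fun x : tup n => (char_poly (feval x a))`_m).
Proof.
have entry i j : regpoly (fun x : tup n => char_poly_mx (feval x a) i j).
  under eq_fun do rewrite !mxE.
  apply: regpoly_add; first exact: regpoly_cst.
  move=> k; under eq_fun do rewrite -rmorphN coefC.
  case: (k == 0%N); last exact: regfun_cst.
  under eq_fun do rewrite -mulN1r.
  by apply: regfun_mul; [exact: regfun_cst | exact: regfun_feval].
have prodP (s : 'I_n -> 'I_n) r : regpoly (fun x : tup n =>
    \prod_(i <- r) char_poly_mx (feval x a) i (s i)).
  elim: r => [|i r IH]; first by under eq_fun do rewrite big_nil; exact: regpoly_cst.
  by under eq_fun do rewrite big_cons; apply: regpoly_mul.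
rewrite /char_poly /determinant; under eq_fun do rewrite coef_sum.
apply: regfun_sum => s; move: m; apply: regpoly_mul => //.
exact: regpoly_cst.
Qed.

(** Serves to vary one summand at a time. The inverse determinant of a sum is a product of inverses,
    also under the default value 0. *)
Lemma regfun_dsumr n m (x : tup n) (F : tup (n + m) -> K) :
  regfun F -> regfun (fun y : tup m => F (dsum x y)).
Proof.
elim=> {F} [c|k i j|k|F G _ IF _ IG|F G _ IF _ IG].
- exact: regfun_cst.
- case: (splitP i) => i' ei; case: (splitP j) => j' ej.
  + have [-> ->] : i = lshift m i' /\ j = lshift m j' by split; exact: val_inj.
    by rewrite /dsum /ltri; under eq_fun do rewrite block_mxEul; exact: regfun_cst.
  + have [-> ->] : i = lshift m i' /\ j = rshift n j' by split; exact: val_inj.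
    by rewrite /dsum /ltri; under eq_fun do rewrite block_mxEur; exact: regfun_cst.
  + have [-> ->] : i = rshift n i' /\ j = lshift m j' by split; exact: val_inj.
    by rewrite /dsum /ltri; under eq_fun do rewrite block_mxEdl; exact: regfun_cst.
  + have [-> ->] : i = rshift n i' /\ j = rshift n j' by split; exact: val_inj.
    by rewrite /dsum /ltri; under eq_fun do rewrite block_mxEdr; exact: regfun_entry.
- rewrite /dsum /ltri; under eq_fun do rewrite det_lblock invfM.
  by apply: regfun_mul; [exact: regfun_cst | exact: regfun_invdet].
- exact: regfun_add.
- exact: regfun_mul.
Qed.

Lemma regfun_dsuml n m (y : tup m) (F : tup (n + m) -> K) :
  regfun F -> regfun (fun x : tup n => F (dsum x y)).
Proof.
elim=> {F} [c|k i j|k|F G _ IF _ IG|F G _ IF _ IG].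
- exact: regfun_cst.
- case: (splitP i) => i' ei; case: (splitP j) => j' ej.
  + have [-> ->] : i = lshift m i' /\ j = lshift m j' by split; exact: val_inj.
    by rewrite /dsum /ltri; under eq_fun do rewrite block_mxEul; exact: regfun_entry.
  + have [-> ->] : i = lshift m i' /\ j = rshift n j' by split; exact: val_inj.
    by rewrite /dsum /ltri; under eq_fun do rewrite block_mxEur; exact: regfun_cst.
  + have [-> ->] : i = rshift n i' /\ j = lshift m j' by split; exact: val_inj.
    by rewrite /dsum /ltri; under eq_fun do rewrite block_mxEdl; exact: regfun_cst.
  + have [-> ->] : i = rshift n i' /\ j = rshift n j' by split; exact: val_inj.
    by rewrite /dsum /ltri; under eq_fun do rewrite block_mxEdr; exact: regfun_cst.
- rewrite /dsum /ltri; under eq_fun do rewrite det_lblock invfM.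
  by apply: regfun_mul; [exact: regfun_invdet | exact: regfun_cst].
- exact: regfun_add.
- exact: regfun_mul.
Qed.

(* The determinants do not depend on the lower left block. *)
Lemma regfun_ltri_poly n m (x : tup n) c (y : tup m) (F : tup (n + m) -> K) :
  regfun F -> exists p : {poly K}, forall t, F (ltri x (fun k => t *: c k) y) = p.[t].
Proof.
elim=> {F} [e|k i j|k|F G _ [p pE] _ [q qE]|F G _ [p pE] _ [q qE]].
- by exists e%:P => t; rewrite hornerC.
- exists ((block_mx (x k) 0 0 (y k) i j)%:P + (block_mx 0 0 (c k) 0 i j) *: 'X) => t.
  rewrite !hornerE -/(block_mx _ _ _ _) mulrC.
  transitivity ((block_mx (x k) 0 0 (y k) + t *: block_mx 0 0 (c k) 0) i j).
    by rewrite scale_block_mx !scaler0 add_block_mx !addr0 add0r.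
  by rewrite !mxE.
- exists ((\det (x k) * \det (y k))^-1)%:P => t.
  by rewrite /ltri det_lblock hornerC.
- by exists (p + q) => t; rewrite hornerD pE qE.
- by exists (p * q) => t; rewrite hornerM pE qE.
Qed.

End RegularFunctions.

(** * Invariant functions and traces *)

Section Representations.
Variables (K : closedFieldType) (Gamma : groupType) (d : nat) (gens : 'I_d -> Gamma).
Hypothesis gens_gen : generates gens.
Hypothesis charK0 : [pchar K] =i pred0.

Local Notation tup n := ('I_d -> 'M[K]_n).
Local Notation rep n := (@rep_variety K Gamma d gens n).

Lemma regular_regfun n (f : rep n -> K) : regular f ->
  exists2 F : tup n -> K, regfun F & f = F \o val.
Proof.
elim=> {f} [c|k i j|k|f g _ [F rF ->] _ [G rG ->]|f g _ [F rF ->] _ [G rG ->]].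
- by exists (fun=> c) => //; exact: regfun_cst.
- by exists (fun x => x k i j) => //; exact: regfun_entry.
- by exists (fun x => (\det (x k))^-1) => //; exact: regfun_invdet.
- by exists (fun x => F x + G x) => //; exact: regfun_add.
- by exists (fun x => F x * G x) => //; exact: regfun_mul.
Qed.

Lemma regfun_regular n (F : tup n -> K) : regfun F ->
  regular (F \o val : rep n -> K).
Proof.
elim=> {F} [c|k i j|k|F G _ IF _ IG|F G _ IF _ IG].
- exact: (@regular_cst K Gamma d gens n c).
- exact: regular_entry.
- exact: regular_invdet.
- exact: (regular_add IF IG).
- exact: (regular_mul IF IG).
Qed.

Lemma rep_dsum n m (x : tup n) (y : tup m) : rep n x -> rep m y -> rep (n + m)%N (dsum x y).
Proof.
move=> [r [rU r1 rM] ->] [s [sU s1 sM] ->].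
exists (fun g => block_mx (r g) 0 0 (s g)) => //; split=> [g||g h].
- by rewrite unitmxE det_lblock unitrM -!unitmxE rU sU.
- by rewrite r1 s1 -scalar_mx_block.
- by rewrite mulmx_block !mul0mx !mulmx0 !addr0 add0r rM sM.
Qed.

Lemma rep_scalar1 n : rep n (fun=> 1%:M).
Proof. by exists (fun=> 1%:M) => //; split => *; rewrite ?unitmx1 ?mulmx1. Qed.

(** Only the generators are known to be triangular. The elements that, together with their inverses,
    have zero upper right block form a subgroup containing the generators. *)
Lemma rep_ltri n m (x : tup n) c (y : tup m) :
  rep (n + m)%N (ltri x c y) -> rep n x /\ rep m y.
Proof.
move=> [r [rU r1 rM] rE].
have ri i : r (gens i) = block_mx (x i) 0 (c i) (y i) by have := congr1 (@^~ i) rE.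
have ur (g : Gamma) : ursubmx (r g) = 0.
  pose H : {pred Gamma} := fun g => `[< ursubmx (r g) = 0 /\ ursubmx (r g^-1%g) = 0 >].
  suff /asboolP[] : g \in H by [].
  have urM A B : ursubmx A = 0 -> ursubmx B = 0 -> ursubmx (A *m B : 'M[K]_(n + m)) = 0.
    move=> A0 B0; rewrite -[A]submxK -[B]submxK mulmx_block A0 B0 block_mxKur.
    by rewrite mulmx0 mul0mx addr0.
  apply: gens_gen => [|i].
    split=> [|g1 g2 /asboolP[a1 b1] /asboolP[a2 b2]]; apply/asboolP.
      by rewrite invg1 r1 scalar_mx_block block_mxKur.
    by rewrite invgM invgK !rM; split; apply: urM.
  (* Invertibility of the block [x i] makes the inverse of a generator triangular too. *)
  have inv : r (gens i) *m r (gens i)^-1%g = 1%:M by rewrite -rM mulgV r1.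
  apply/asboolP; split; first by rewrite ri block_mxKur.
  have xU : x i \in unitmx.
    by have := rU (gens i); rewrite ri unitmxE det_lblock unitrM -!unitmxE => /andP[].
  have := inv; rewrite ri -[r _^-1%g]submxK mulmx_block scalar_mx_block.
  move=> /eq_block_mx[_ + _ _]; rewrite mul0mx addr0 => h.
  by rewrite block_mxKur -[LHS](mulKmx xU) h mulmx0.
have rB g : r g = block_mx (ulsubmx (r g)) 0 (dlsubmx (r g)) (drsubmx (r g)).
  by rewrite -[LHS]submxK ur.
have rBU g : ulsubmx (r g) \in unitmx /\ drsubmx (r g) \in unitmx.
  by have := rU g; rewrite {1}rB unitmxE det_lblock unitrM -!unitmxE => /andP[].
split.
- exists (fun g => ulsubmx (r g)).
    split=> [g||g h]; first by case: (rBU g).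
      by rewrite r1 scalar_mx_block block_mxKul.
    by rewrite rM rB (rB h) mulmx_block !block_mxKul mul0mx addr0.
  by apply/funext => i; rewrite /= ri block_mxKul.
- exists (fun g => drsubmx (r g)).
    split=> [g||g h]; first by case: (rBU g).
      by rewrite r1 scalar_mx_block block_mxKdr.
    by rewrite rM rB (rB h) mulmx_block !block_mxKdr mulmx0 add0r.
  by apply/funext => i; rewrite /= ri block_mxKdr.
Qed.

(** Invariance is imposed on representations only, since a function on all tuples can have an
    invariant restriction without being invariant. *)
Definition invfun n (F : tup n -> K) : Prop :=
  regfun F /\ forall g x, g \in unitmx -> rep n x -> F (adjoint g x) = F x.

Lemma tup_iso_adjoint n (x y : tup n) : tup_iso x y ->
  exists2 g, g \in unitmx & x = adjoint g y.
Proof.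
move=> [P [Q [PQ QP xP]]]; have [PU _] := mulmx1_unit PQ.
exists P => //; apply/funext => k; rewrite /adjoint -xP mulmxK //.
Qed.

Lemma adjoint_tup_iso n (y : tup n) g : g \in unitmx -> tup_iso (adjoint g y) y.
Proof.
move=> gU; exists g, (invmx g); split; rewrite ?mulmxV ?mulVmx // => k.
by rewrite /adjoint mulmxKV.
Qed.

Lemma tup_iso_refl n (x : tup n) : tup_iso x x.
Proof. by exists 1%:M, 1%:M; split=> [||k]; rewrite ?mulmx1 ?mul1mx. Qed.

Lemma tup_iso_dsum n n' m m' (x : tup n) (x' : tup n') (y : tup m) (y' : tup m') :
  tup_iso x x' -> tup_iso y y' -> tup_iso (dsum x y) (dsum x' y').
Proof.
move=> [P [Q [PQ QP xP]]] [R [S [RS SR yR]]].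
exists (block_mx P 0 0 R), (block_mx Q 0 0 S); split=> [||k].
- by rewrite mulmx_block !(mul0mx, mulmx0, addr0, add0r) PQ RS -scalar_mx_block.
- by rewrite mulmx_block !(mul0mx, mulmx0, addr0, add0r) QP SR -scalar_mx_block.
- by rewrite !mulmx_block !(mul0mx, mulmx0, addr0, add0r) xP yR.
Qed.

Lemma invfun_iso n (F : tup n -> K) x y : invfun F -> tup_iso x y -> rep n y -> F x = F y.
Proof. by move=> [_ Fi] /tup_iso_adjoint[g gU ->] ry; rewrite Fi. Qed.

Lemma tup_iso_sym n m (x : tup n) (y : tup m) : tup_iso x y -> tup_iso y x.
Proof.
move=> [P [Q [PQ QP xP]]]; exists Q, P; split=> // k.
by rewrite -[y k]mul1mx -QP -(mulmxA Q) -xP -!mulmxA PQ mulmx1.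
Qed.

Lemma rep_iso n m (x : tup n) (y : tup m) : tup_iso x y -> rep n x -> rep m y.
Proof.
move=> xy; have [P [Q [PQ QP _]]] := xy.
move: (invertible_dim PQ QP) => e {P Q PQ QP}; case: m / e y xy => y xy.
by have [g gU ->] := tup_iso_adjoint (tup_iso_sym xy); exact: rep_variety_adjoint.
Qed.

Lemma invfun_dsumr n m (x : tup n) (F : tup (n + m) -> K) : rep n x ->
  invfun F -> invfun (fun y : tup m => F (dsum x y)).
Proof.
move=> rx iF; split=> [|g y gU ry]; first by apply: regfun_dsumr; case: iF.
apply: invfun_iso => //; last exact: rep_dsum.
by apply: tup_iso_dsum; [exact: tup_iso_refl | exact: adjoint_tup_iso].
Qed.

(** For representations this is equality of their points in the character variety; the cast bridges
    sizes that are equal only propositionally. *)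
Definition inv_eq n m (x : tup n) (y : tup m) : Prop :=
  exists e : n = m, forall F : tup m -> K, invfun F ->
    F (fun k => castmx (e, e) (x k)) = F y.

Lemma inv_eqP n (x y : tup n) : inv_eq x y <-> forall F, invfun F -> F x = F y.
Proof.
have cid (e : n = n) : (fun k => castmx (e, e) (x k)) = x.
  by apply/funext => k; rewrite eq_axiomK castmx_id.
split=> [[e h] F iF|h]; first by rewrite -h // cid.
by exists (erefl n) => F iF; rewrite cid h.
Qed.

Lemma inv_eq_trans n m p (x : tup n) (y : tup m) (z : tup p) :
  inv_eq x y -> inv_eq y z -> inv_eq x z.
Proof.
move=> xy yz; case: (xy) (yz) => e _ [e' _]; case: m / e y xy yz e' => y xy yz e'.
case: p / e' z yz => z /inv_eqP yz; move/inv_eqP: xy => xy.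
by apply/inv_eqP => F iF; rewrite xy ?yz.
Qed.

Lemma inv_eq_sym n m (x : tup n) (y : tup m) : inv_eq x y -> inv_eq y x.
Proof.
move=> xy; case: (xy) => e _; case: m / e y xy => y /inv_eqP xy.
by apply/inv_eqP => F iF; rewrite xy.
Qed.

Lemma inv_eq_iso n m (x : tup n) (y : tup m) : tup_iso x y -> rep m y -> inv_eq x y.
Proof.
move=> xy; have [P [Q [PQ QP _]]] := xy.
move: (invertible_dim PQ QP) => e {P Q PQ QP}; case: m / e y xy => y xy ry.
by apply/inv_eqP => F iF; exact: invfun_iso iF xy ry.
Qed.

Lemma inv_eq_dsumr n m p (x : tup n) (y : tup m) (z : tup p) : rep n x ->
  inv_eq y z -> inv_eq (dsum x y) (dsum x z).
Proof.
move=> rx yz; case: (yz) => e _; case: p / e z yz => z /inv_eqP yz.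
by apply/inv_eqP => F iF; apply: (yz (fun y => F (dsum x y))); exact: invfun_dsumr.
Qed.

Lemma natr_inj : injective (fun i : nat => i%:R : K).
Proof.
move=> i j /eqP; rewrite -subr_eq0; case: (leqP i j) => ij.
  rewrite -opprB oppr_eq0 -natrB // ((pcharf0P K).1 charK0) subn_eq0 => ji.
  by apply/eqP; rewrite eqn_leq ij.
rewrite -natrB 1?ltnW // ((pcharf0P K).1 charK0) subn_eq0 => ji.
by move: ij; rewrite ltnNge ji.
Qed.

(* diag(1, t) conjugates [x 0; c y] to [x 0; t c, y]; let t tend to 0. *)
Lemma inv_eq_ltri n m (x : tup n) c (y : tup m) :
  rep (n + m)%N (ltri x c y) -> inv_eq (ltri x c y) (dsum x y).
Proof.
move=> rxy; apply/inv_eqP => F iF.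
have [p pE] := regfun_ltri_poly x c y iF.1.
have pt t : t != 0 -> p.[t] = F (ltri x c y).
  move=> t0; rewrite -pE; apply: invfun_iso => //.
  exists (block_mx 1%:M 0 0 t%:M), (block_mx 1%:M 0 0 t^-1%:M); split=> [||k].
  - rewrite mulmx_block !(mul0mx, mulmx0, addr0, add0r, mul1mx) -scalar_mxM mulfV //.
    by rewrite -scalar_mx_block.
  - rewrite mulmx_block !(mul0mx, mulmx0, addr0, add0r, mul1mx) -scalar_mxM mulVf //.
    by rewrite -scalar_mx_block.
  - rewrite !mulmx_block !(mul0mx, mulmx0, addr0, add0r, mul1mx, mulmx1).
    by rewrite mul_scalar_mx mul_scalar_mx mul_mx_scalar.
have p0 : F (dsum x y) = p.[0].
  by rewrite -pE; congr (F (ltri _ _ _)); apply/funext => k; rewrite scale0r.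
rewrite p0 -[LHS](hornerC _ 0); congr (_.[_]).
apply/eqP; rewrite -subr_eq0; apply/negPn/negP => q0.
(* The values [i.+1] avoid [t = 0] and are distinct in characteristic 0; they are as many as the
   size of the difference, one too many for its roots. *)
have := max_poly_roots q0
  (rs := [seq i.+1%:R | i <- iota 0 (size ((F (ltri x c y))%:P - p))]).
rewrite size_map size_iota ltnn => /(_ _ _) h.
suff // : false by [].
apply: h; last by rewrite map_inj_uniq ?iota_uniq // => i j /natr_inj[].
apply/allP => _ /mapP[i _ ->]; rewrite /root !hornerE pt ?subrr //.
by rewrite ((pcharf0P K).1 charK0).
Qed.

Lemma block_mx00 m1 m2 n1 n2 : block_mx 0 0 0 0 = 0 :> 'M[K]_(m1 + m2, n1 + n2).
Proof. exact: block_mx_const. Qed.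

(** Induction on the dimension: split off a simple submodule [s]; if [e] kills it, recurse into the
    quotient [t] and move the constituent found there to the front. *)
Lemma rep_constituent (e : falg K d) n (x : tup n) :
  rep n x -> feval x (FMul e e) = feval x e -> feval x e != 0 ->
  exists m p (s : tup m) (t : tup p), [/\ rep m s, rep p t, irred s, inv_eq x (dsum s t) &
    feval s e != 0 /\ forall a, feval x a = 0 -> feval s a = 0].
Proof.
have [N] := ubnP n; elim: N n x => // N IH n x nN rx ee ex.
have n0 : (0 < n)%N by case: n x {nN rx ee} ex => // x; rewrite flatmx0 eqxx.
have [m [p [s [c [t [irs iso]]]]]] := irred_sub x n0.
have [P [Q [PQ QP _]]] := iso.
have nE := invertible_dim PQ QP.
have rl := rep_iso iso rx; have [rs rt] := rep_ltri rl.
have xst : inv_eq x (dsum s t) := inv_eq_trans (inv_eq_iso iso rl) (inv_eq_ltri rl).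
have ann a : feval x a = 0 -> feval s a = 0 /\ feval t a = 0.
  move=> /(tup_iso_eval0 iso); have [C ->] := feval_ltri s c t a.
  by rewrite -block_mx00 => /eq_block_mx[].
have [se|se] := eqVneq (feval s e) 0; last first.
  by exists m, p, s, t; split=> //; split=> // a /ann[].
(* If [e] vanished on [s] and on [t], it would be strictly block triangular and its square would be
   0, against idempotence. *)
have te : feval t e != 0.
  apply: contraNneq ex => te; apply/eqP; rewrite -ee.
  apply: (tup_iso_eval0 (tup_iso_sym iso)) => /=; have [C ->] := feval_ltri s c t e.
  rewrite se te mulmx_block !(mul0mx, mulmx0, addr0).
  by rewrite -block_mx00.
have tee : feval t (FMul e e) = feval t e.
  apply/eqP; rewrite -subr_eq0 -feval_sub; apply/eqP.
  by have [] := ann (fsub (FMul e e) e); rewrite // feval_sub ee subrr.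
have pN : (p < N)%N.
  by rewrite -ltnS; apply: leq_trans nN; rewrite nE ltnS -[p.+1]add1n leq_add2r; case: irs.
have [m' [p' [s' [t' [rs' rt' irs' tst [s'e ann']]]]]] := IH p t pN rt tee te.
exists m', (m + p')%N, s', (dsum s t'); split=> //; first exact: rep_dsum.
  apply: inv_eq_trans xst _; apply: inv_eq_trans (inv_eq_dsumr rs tst) _.
  apply: inv_eq_iso; first exact: tup_iso_dsumCA.
  by apply: rep_dsum => //; exact: rep_dsum.
by split=> // a /ann[_ /ann'].
Qed.

Lemma inv_eq_trace n m (x : tup n) (y : tup m) a : inv_eq x y ->
  \tr (feval x a) = \tr (feval y a).
Proof.
move=> xy; case: (xy) => e _; case: m / e y xy => y /inv_eqP xy.
apply: (xy (fun y => \tr (feval y a))); split.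
  by apply: regfun_sum => i; exact: regfun_feval.
move=> g z gU _; exact: tup_iso_trace (adjoint_tup_iso z gU).
Qed.

(** Induction on the dimension. A nonzero idempotent [e] of minimal rank in the algebra generated by
    [dsum x y] has a local corner and acts nontrivially on both [x] and [y]. Constituents of [x] and
    [y] not killed by [e] share [lam], so they are isomorphic and can be cancelled. *)
Lemma trace_inv_eq n m (x : tup n) (y : tup m) : rep n x -> rep m y ->
  (forall a, \tr (feval x a) = \tr (feval y a)) -> inv_eq x y.
Proof.
have [N] := ubnP n; elim: N n m x y => // N IH n m x y nN rx ry xy.
have nm : n = m.
  by apply: natr_inj; have := xy (FCst d 1); rewrite /= !mxtrace1.
have [n0|n0] := posnP n.
  apply: inv_eq_iso => //; exists 0, 0; case: m / nm y ry xy => y _ _.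
  by rewrite n0 in x rx nN y *; split=> [||k]; rewrite [LHS]flatmx0 [RHS]flatmx0.
pose z := dsum x y.
have idem_split a : feval z (FMul a a) = feval z a -> feval z a != 0 ->
    [/\ feval x (FMul a a) = feval x a, feval y (FMul a a) = feval y a,
    feval x a != 0 & feval y a != 0].
  rewrite !feval_dsum => /eq_block_mx[xx _ _ yy] a0.
  (* In characteristic 0 the trace of an idempotent determines its rank. *)
  have rk : \rank (feval x a) = \rank (feval y a).
    by apply: natr_inj; have := xy a; rewrite !idempotent_trace.
  have xy0 : (feval x a == 0) = (feval y a == 0) by rewrite -!mxrank_eq0 rk.
  split=> //; apply: contraNneq a0 => h.
    by have /eqP h' : feval y a == 0; [rewrite -xy0 h | rewrite h h' block_mx00].
  by have /eqP h' : feval x a == 0; [rewrite xy0 h | rewrite h h' block_mx00].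
have [e [ee e0 emin]] : exists e, [/\ feval z (FMul e e) = feval z e, feval z e != 0 &
    forall a, feval z (FMul a a) = feval z a -> feval z a != 0 ->
    (\rank (feval z e) <= \rank (feval z a))%N].
  have ex : exists k, `[< exists e, [/\ feval z (FMul e e) = feval z e, feval z e != 0 &
      \rank (feval z e) = k] >].
    exists (\rank (1%:M : 'M[K]_(n + m))); apply/asboolP; exists (FCst d 1).
    by split=> //=; rewrite ?mulmx1 // -mxrank_eq0 mxrank1 -lt0n addn_gt0 n0.
  case: (ex_minnP ex) => k /asboolP[e [ee e0 ek]] kmin; exists e; split=> // a aa a0.
  by rewrite ek; apply: kmin; apply/asboolP; exists a.
have /choice[lam /choice[nu nil]] := fun b => minimal_idempotent_corner b ee e0 emin.
have [eex eey ex ey] := idem_split e ee e0.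
have annz a : feval z a = 0 -> feval x a = 0 /\ feval y a = 0.
  by rewrite feval_dsum -block_mx00 => /eq_block_mx[].
have [n1 [n2 [s [t [rs rt irs xst [es anns]]]]]] := rep_constituent rx eex ex.
have [m1 [m2 [s' [t' [rs' rt' irs' yst [es' anns']]]]]] := rep_constituent ry eey ey.
have idem_of k (w : tup k) : (forall a, feval z a = 0 -> feval w a = 0) ->
    feval w (FMul e e) = feval w e.
  move=> annw; apply/eqP; rewrite -subr_eq0 -feval_sub; apply/eqP/annw.
  by rewrite feval_sub ee subrr.
have zs a : feval z a = 0 -> feval s a = 0 by move=> /annz[/anns].
have zs' a : feval z a = 0 -> feval s' a = 0 by move=> /annz[_ /anns'].
have ss' : tup_iso s s'.
  apply: (common_constituent_iso (e := e) (lam := lam) (nu := nu)) => // [|b||b].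
  - exact: idem_of.
  - by apply: zs.
  - exact: idem_of.
  - by apply: zs'.
have yst' : inv_eq y (dsum s t').
  apply: inv_eq_trans yst (inv_eq_iso _ (rep_dsum rs rt')).
  by apply: tup_iso_dsum; [exact: tup_iso_sym | exact: tup_iso_refl].
have tt' : inv_eq t t'.
  apply: IH => // [|a].
    have [xe _] := xst; rewrite -ltnS; apply: leq_trans nN.
    by rewrite xe ltnS -[n2.+1]add1n leq_add2r; case: irs.
  have := xy a; rewrite (inv_eq_trace a xst) (inv_eq_trace a yst').
  by rewrite !feval_dsum !mxtrace_block => /addrI.
apply: inv_eq_trans xst (inv_eq_trans (inv_eq_dsumr rs tt') _).
exact: inv_eq_sym yst'.
Qed.

End Representations.

(** * Irreducible sets of representations *)

Section IrreducibleSets.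
Variables (K : closedFieldType) (d : nat).
Local Notation tup n := ('I_d -> 'M[K]_n).
Local Open Scope classical_set_scope.

(** The functions vanishing on [S] form a prime ideal; equivalently, the Zariski closure of [S] is
    irreducible. *)
Definition irreducible_set n (S : set (tup n)) : Prop :=
  S !=set0 /\ forall F G, regfun F -> regfun G -> (forall x, S x -> F x * G x = 0) ->
    (forall x, S x -> F x = 0) \/ (forall x, S x -> G x = 0).

Definition dsum_set n m (S : set (tup n)) (T : set (tup m)) : set (tup (n + m)) :=
  [set z | exists x y, [/\ S x, T y & z = dsum x y]].

Lemma irreducible_set1 n (x : tup n) : irreducible_set [set x].
Proof.
split=> [|F G _ _ FG]; first by exists x.
have /eqP := FG x erefl; rewrite mulf_eq0 => /orP[]/eqP h; [left|right];
  by move=> _ ->.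
Qed.

(** Irreducibility of [T] provides one [y] at which both [F] with first summand [x1] and [G] with
    first summand [x2] are nonzero; irreducibility of [S] for this fixed [y] gives the
    contradiction. *)
Lemma irreducible_dsum_set n m (S : set (tup n)) (T : set (tup m)) :
  irreducible_set S -> irreducible_set T -> irreducible_set (dsum_set S T).
Proof.
move=> [[x0 Sx0] irS] [[y0 Ty0] irT]; split; first by exists (dsum x0 y0), x0, y0.
move=> F G rF rG FG; apply: contrapT => /not_orP[].
move=> /existsNP[_ /not_implyP[[x1 [y1 [Sx1 Ty1 ->]]] F1]].
move=> /existsNP[_ /not_implyP[[x2 [y2 [Sx2 Ty2 ->]]] G2]].
have [y [Ty Fy Gy]] : exists y, [/\ T y, F (dsum x1 y) <> 0 & G (dsum x2 y) <> 0].
  apply: contrapT => h.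
  have [||y Ty|h1|h1] := irT (fun y => F (dsum x1 y)) (fun y => G (dsum x2 y)).
  - exact: regfun_dsumr.
  - exact: regfun_dsumr.
  - apply/eqP; rewrite mulf_eq0; apply: contrapT => /negP; rewrite negb_or.
    move=> /andP[/eqP ? /eqP ?].
    by apply: h; exists y.
  - exact: F1 (h1 _ Ty1).
  - exact: G2 (h1 _ Ty2).
have [||x Sx|h1|h1] := irS (fun x => F (dsum x y)) (fun x => G (dsum x y)).
- exact: regfun_dsuml.
- exact: regfun_dsuml.
- by apply: FG; exists x, y.
- exact: Fy (h1 _ Sx1).
- exact: Gy (h1 _ Sx2).
Qed.

(* The functions that vanish U-almost everywhere, for an ultrafilter U avoiding
   every finite union of fibres of F, form a prime ideal; since it is finitely
   generated, its zero set belongs to U. *)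
Lemma irreducible_subset_nonconstant n (X : set (tup n)) F : regfun F ->
  (forall s : seq K, exists2 x, X x & F x \notin s) ->
  exists Z, [/\ irreducible_set Z, Z `<=` X & exists x y, [/\ Z x, Z y & F x != F y]].
Proof.
move=> rF Finf.
pose I : finType := (('I_d * 'I_n * 'I_n) + 'I_d)%type.
pose t (i : I) (x : tup n) := match i with
  | inl (k, i, j) => x k i j | inr k => (\det (x k))^-1 end.
have [A [phi [nA cst gen]]] := noetherian_cover t (enum I).
have lift G : regfun G -> exists a, forall x, phi x a = G x.
  elim=> {G} [c|k i j|k|G H _ [a aE] _ [b bE]|G H _ [a aE] _ [b bE]].
  - exact: cst.
  - by have [|a aE] := gen (inl (k, i, j)); [rewrite mem_enum | exists a].
  - by have [|a aE] := gen (inr k); [rewrite mem_enum | exists a].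
  - by exists (a + b) => x; rewrite rmorphD aE bE.
  - by exists (a * b) => x; rewrite rmorphM aE bE.
(* The sets containing [X] up to finitely many fibres of [F]; [Finf] makes this filter proper. *)
pose Fil : set_system (tup n) :=
  [set B | exists s : seq K, forall x, X x -> F x \notin s -> B x].
have FilP : ProperFilter Fil.
  split; first by move=> [s h]; have [x Xx Fx] := Finf s; exact: h Xx Fx.
  split=> [|B C [s sB] [u uC]|B C BC [s sB]].
  - by exists [::].
  - exists (s ++ u) => x Xx; rewrite mem_cat negb_or => /andP[? ?].
    by split; [exact: sB | exact: uC].
  - by exists s => x Xx Fx; apply: BC; exact: sB.
have [U [UU FilU]] := ultraFilterLemma FilP.
have U0 : ~ U set0 by exact: filter_not_empty.
pose J a := U [set x | phi x a = 0].
have idJ : ideal_prop J.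
  split=> [|a b Ja Jb|a b Jb].
  - by apply: filterS filterT => x _ /=; rewrite rmorph0.
  - by apply: filterS (filterI Ja Jb) => x [/= xa xb]; rewrite rmorphD xa xb addr0.
  - by apply: filterS Jb => x /= xb; rewrite rmorphM xb mulr0.
have [l lJ lP] := nA J idJ.
pose Z := X `&` [set x | {in l, forall a, phi x a = 0}].
have UZ : U Z.
  apply: filterI; first by apply: FilU; exists [::].
  elim: (l) lJ => [|a l' IH] lJ.
    by apply: filterS filterT => x _ a.
  have Ja : J a by apply: lJ; rewrite mem_head.
  have lJ' : {in l', forall b, J b} by move=> b lb; apply: lJ; rewrite inE lb orbT.
  apply: filterS (filterI Ja (IH lJ')) => x [/= xa xl] b.
  by rewrite inE => /predU1P[->|/xl].
have J0 a : J a -> forall x, Z x -> phi x a = 0.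
  move=> Ja x [_ xl]; apply: (lP (fun b => phi x b = 0)) Ja => //.
  split=> [|b c xb xc|b c xc]; first by rewrite rmorph0.
    by rewrite rmorphD xb xc addr0.
  by rewrite rmorphM xc mulr0.
have UZex B : U B -> exists x, Z x /\ B x.
  move=> UB; apply: contrapT => h; apply: U0.
  by apply: filterS (filterI UZ UB) => x [Zx Bx]; apply: h; exists x.
exists Z; split; first split.
- by have [x []] := UZex _ UZ; exists x.
- move=> G H /lift[a aG] /lift[b bH] GH.
  (* The ultrafilter decides whether [G] vanishes almost everywhere; if not, [H] does, as [G] times
     [H] is 0 on [Z]. *)
  have [Ua|Ua] := in_ultra_setVsetC [set x | phi x a = 0] UU.
    by left=> x Zx; rewrite -aG; exact: J0.
  right=> x Zx; rewrite -bH; apply: J0 => //.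
  apply: filterS (filterI UZ Ua) => y [Zy /= ya].
  have /eqP := GH y Zy; rewrite mulf_eq0 => /orP[/eqP Gy|/eqP Hy].
    by case: ya; rewrite aG.
  by rewrite bH.
- by move=> x [].
- have [x [Zx _]] := UZex _ UZ.
  have [|y [Zy /= yx]] := UZex [set y | F y \notin [:: F x]].
    by apply: FilU; exists [:: F x].
  by exists x, y; split=> //; move: yx; rewrite inE eq_sym.
Qed.

(** * Order of vanishing at 0 of characteristic polynomials *)

Definition ord_at0 n (a : falg K d) (x : tup n) : nat := mup 0 (char_poly (feval x a)).

Lemma char_poly_neq0 n (M : 'M[K]_n) : char_poly M != 0.
Proof. exact/monic_neq0/char_poly_monic. Qed.

Lemma ord_at0_dsum n m a (x : tup n) (y : tup m) : ord_at0 a (dsum x y) = (ord_at0 a x + ord_at0 a y)%N.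
Proof.
rewrite /ord_at0 feval_dsum -mupM ?char_poly_neq0 //; congr (mup _ _).
rewrite /char_poly /char_poly_mx map_block_mx !map_mx0 scalar_mx_block.
by rewrite opp_block_mx add_block_mx !subr0 det_ublock.
Qed.

Lemma coef_lt_mup0 (p : {poly K}) j : p != 0 -> (j < mup 0 p)%N -> p`_j = 0.
Proof.
move=> p0; have := mup_geq 0 (mup 0 p) p0; rewrite leqnn subr0 => /esym/dvdpP[q qE] jm.
by rewrite {1}qE coefMXn jm.
Qed.

Lemma coef_mup0 (p : {poly K}) : p != 0 -> p`_(mup 0 p) != 0.
Proof.
move=> p0; have := mup_geq 0 (mup 0 p) p0; rewrite leqnn subr0 => /esym/dvdpP[q qE].
have := mup_geq 0 (mup 0 p).+1 p0; rewrite ltnn subr0 => /esym; apply: contraFneq.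
rewrite {1}qE coefMXn ltnn subnn => q0.
have : root q 0 by rewrite /root horner_coef0 q0.
move=> /factor_theorem[r rE]; rewrite subr0 in rE.
by apply/dvdpP; exists r; rewrite {1}qE rE exprS mulrA.
Qed.

(** For irreducible [S] this is the order at a generic point: a larger order means that the
    coefficient of index [m] vanishes. *)
Definition min_ord_at0 n (a : falg K d) (S : set (tup n)) (m : nat) : Prop :=
  (forall x, S x -> (m <= ord_at0 a x)%N) /\ exists2 x, S x & ord_at0 a x = m.

Lemma min_ord_at0_ex n a (S : set (tup n)) : S !=set0 -> exists m, min_ord_at0 a S m.
Proof.
move=> [x Sx].
have ex : exists m, `[< exists2 x, S x & ord_at0 a x = m >].
  by exists (ord_at0 a x); apply/asboolP; exists x.
case: (ex_minnP ex) => m /asboolP[y Sy ym] mmin; exists m; split; last by exists y.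
by move=> w Sw; apply: mmin; apply/asboolP; exists w.
Qed.

Lemma min_ord_at0_dsum n m a (S : set (tup n)) (T : set (tup m)) k l :
  min_ord_at0 a S k -> min_ord_at0 a T l -> min_ord_at0 a (dsum_set S T) (k + l).
Proof.
move=> [Sk [x Sx xk]] [Tl [y Ty yl]]; split.
  by move=> _ [v [w [Sv Tw ->]]]; rewrite ord_at0_dsum leq_add ?Sk ?Tl.
by exists (dsum x y); [exists x, y | rewrite ord_at0_dsum xk yl].
Qed.

(** Different traces force different characteristic polynomials, hence a root [l] with different
    multiplicities; subtracting [l] from [a] moves it to 0. *)
Lemma separating_ord_at0 n (x y : tup n) a : \tr (feval x a) != \tr (feval y a) ->
  exists b, ord_at0 b x != ord_at0 b y.
Proof.
case: n x y => [x y|n x y xy]; first by rewrite [feval x a]flatmx0 [feval y a]flatmx0 eqxx.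
have [l lP] : exists l, mup l (char_poly (feval x a)) != mup l (char_poly (feval y a)).
  apply: contrapT => h; move/negP: xy; apply.
  rewrite -eqr_opp -!char_poly_trace //.
  suff -> : char_poly (feval x a) = char_poly (feval y a) by [].
  have [rs rsE] := closed_field_poly_normal (char_poly (feval x a)).
  have [rs' rsE'] := closed_field_poly_normal (char_poly (feval y a)).
  rewrite (monicP (char_poly_monic _)) scale1r in rsE.
  rewrite (monicP (char_poly_monic _)) scale1r in rsE'.
  rewrite rsE rsE'; apply: perm_big; apply/allP => l _ /=.
  rewrite -!mu_prod_XsubC -rsE -rsE'; apply/negPn/negP => lP.
  by apply: h; exists l.
exists (fsub a (FCst d l)); apply: contraNneq lP.
have shift (z : tup n.+1) :
    mup l (char_poly (feval z a)) = ord_at0 (fsub a (FCst d l)) z.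
  rewrite /ord_at0.
  have -> : char_poly (feval z (fsub a (FCst d l))) = char_poly (feval z a) \Po ('X + l%:P).
    rewrite /char_poly -[RHS]det_map_mx; congr (\det _).
    apply/matrixP => i j; rewrite feval_sub !mxE /= !(rmorphB, rmorphMn) /=.
    rewrite comp_polyX comp_polyC mulrnDl -addrA; congr (_ + _).
    by rewrite opprB addrC.
  have [rs rsE] := closed_field_poly_normal (char_poly (feval z a)).
  rewrite (monicP (char_poly_monic _)) scale1r in rsE.
  rewrite rsE rmorph_prod mu_prod_XsubC.
  under eq_bigr do rewrite /= comp_polyB comp_polyX comp_polyC -addrA -opprB -polyCB.
  rewrite -(big_map (fun z => z - l) xpredT (fun z => 'X - z%:P)) mu_prod_XsubC count_map.
  by apply: eq_count => w /=; rewrite subr_eq0.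
by rewrite !shift => ->.
Qed.

End IrreducibleSets.

(** * Chains of prime ideals *)

Section PrimeChains.
Variables (K : closedFieldType) (Gamma : groupType) (d : nat) (gens : 'I_d -> Gamma).
Hypothesis gens_gen : generates gens.
Hypothesis charK0 : [pchar K] =i pred0.
Local Open Scope classical_set_scope.

Local Notation tup n := ('I_d -> 'M[K]_n).
Local Notation rep n := (@rep_variety K Gamma d gens n).

Lemma char_ring_regfun n (f : char_ring K gens n) :
  exists2 F : tup n -> K, invfun gens F & forall X : rep n, f X = F (val X).
Proof.
case: f => f /= fP; have /asboolP[/regular_regfun[F rF fE] fi] := fP.
exists F => [|X]; last by rewrite fE.
split=> // g x gU rx; have ry : rep n (adjoint g x) by exact: rep_variety_adjoint.
by have := fi g (SigSub (mem_set rx)) (SigSub (mem_set ry)) gU erefl; rewrite fE.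
Qed.

Lemma regfun_char_ring n (F : tup n -> K) : invfun gens F ->
  exists f : char_ring K gens n, forall X : rep n, f X = F (val X).
Proof.
move=> [rF Fi].
have fP : (F \o val : rep n -> K) \in @invariant_regular K Gamma d gens n.
  apply/asboolP; split; first exact: regfun_regular.
  by move=> g x y gU /= ->; apply: Fi => //; apply: set_mem; exact: (valP x).
by exists (CharRing fP).
Qed.

Lemma irreducible_prime n (S : set (tup n)) : irreducible_set S -> S `<=` rep n ->
  exists p : prime_idealr (char_ring K gens n), forall f,
    f \in p <-> forall X : rep n, S (val X) -> f X = 0.
Proof.
move=> [[x0 Sx0] irS] SR.
pose P : char_ring K gens n -> bool := fun f => `[< forall X : rep n, S (val X) -> f X = 0 >].
have P1 : idealr_closed P.
  split.
  - by apply/asboolP.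
  - apply/negP => /asboolP/(_ (SigSub (mem_set (SR _ Sx0))) Sx0)/eqP.
    by rewrite /= oner_eq0.
  - move=> a u v /asboolP Pu /asboolP Pv; apply/asboolP => X SX.
    transitivity (a X * u X + v X); first by [].
    by rewrite Pu // Pv // mulr0 addr0.
have P2 : prime_idealr_closed P.
  move=> u v /asboolP uv; apply/orP.
  have [F [rF _] FE] := char_ring_regfun u; have [G [rG _] GE] := char_ring_regfun v.
  have [x Sx|FS|GS] := irS F G rF rG.
  - have := uv (SigSub (mem_set (SR _ Sx))) Sx.
    by rewrite -[LHS]/(u _ * v _) FE GE.
  - by left; apply/asboolP => X SX; rewrite FE FS.
  - by right; apply/asboolP => X SX; rewrite GE GS.
pose p : prime_idealr (char_ring K gens n) :=
  HB.pack P (isIdealr.Build _ P P1) (isPrimeIdealrClosed.Build _ P P2).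
by exists p => f; split=> [/asboolP|h]; last apply/asboolP.
Qed.

Lemma prime_chain_sets n m (S : nat -> set (tup n)) (F : nat -> tup n -> K) :
  (forall i, (i <= m)%N -> [/\ irreducible_set (S i), S i `<=` rep n & invfun gens (F i)]) ->
  (forall i, (i < m)%N -> [/\ S i.+1 `<=` S i, forall x, S i.+1 x -> F i x = 0 &
    exists2 x, S i x & F i x <> 0]) ->
  prime_chain (char_ring K gens n) m.
Proof.
move=> HS HF.
have /choice[p pP] i : exists p : prime_idealr (char_ring K gens n), (i <= m)%N ->
    forall f, f \in p <-> forall X : rep n, S i (val X) -> f X = 0.
  have [im|im] := leqP i m.
    by have [irS SR _] := HS i im; have [p pP] := irreducible_prime irS SR; exists p.
  (* The choice asks for a prime ideal at every index; beyond [m] the ideal of [S 0] is taken. *)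
  have [irS SR _] := HS 0%N (leq0n _).
  by have [p _] := irreducible_prime irS SR; exists p.
exists p => i im; have [SS F0 [x Sx Fx]] := HF i im.
have [_ SR iF] := HS i (ltnW im); split.
  move=> f /(pP i (ltnW im)) fS; apply/(pP i.+1 im) => X SX.
  by apply: fS; exact: SS.
have [f fE] := regfun_char_ring iF.
move=> /(_ f) h; have /h : f \in (p i.+1).
  by apply/(pP i.+1 im) => X SX; rewrite fE F0.
move=> /(pP i (ltnW im))/(_ (SigSub (mem_set (SR _ Sx))) Sx).
by rewrite fE.
Qed.

Lemma invfun_char_poly n (a : falg K d) m :
  invfun gens (fun x : tup n => (char_poly (feval x a))`_m).
Proof.
split=> [|g x gU _]; first exact: regfun_char_poly.
have gx : feval (adjoint g x) a *m g = g *m feval x a.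
  by apply: feval_intertwine => k; rewrite /adjoint mulmxKV.
suff -> : char_poly (feval (adjoint g x) a) = char_poly (feval x a) by [].
(* Similarity is lifted to matrices of polynomials, where the determinants of [C g] and of its
   inverse cancel. *)
pose C (A : 'M[K]_n) := map_mx (@polyC K) A.
have CV : C g *m C (invmx g) = 1%:M by rewrite -map_mxM mulmxV // map_scalar_mx.
have h : char_poly_mx (feval (adjoint g x) a) *m C g = C g *m char_poly_mx (feval x a).
  rewrite /char_poly_mx mulmxBl mulmxBr -!map_mxM gx.
  by rewrite mul_scalar_mx mul_mx_scalar.
rewrite /char_poly -[LHS]mulr1 -(det1 _ n) -CV det_mulmx mulrA -det_mulmx h det_mulmx.
by rewrite mulrAC -det_mulmx CV det1 mul1r.
Qed.

(** * The decreasing sets of direct sums *)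

Section Tower.
Variables (n0 r : nat) (Z : set (tup n0)) (z0 : tup n0).

Fixpoint tower_dim (k : nat) : nat := if k is k'.+1 then (n0 + tower_dim k')%N else r.

Lemma tower_dimE k : tower_dim k = (k * n0 + r)%N.
Proof. by elim: k => //= k ->; rewrite mulSn addnA. Qed.

(** This is [Y_i], with sums nested so that the size is [tower_dim k] by conversion. As [i.-1] is 0
    at 0, the summands after the first [i] range over [Z]. *)
Fixpoint tower (k i : nat) : set (tup (tower_dim k)) :=
  match k return set (tup (tower_dim k)) with
  | 0 => [set (fun=> 1%:M)]
  | k'.+1 => dsum_set (if i is _.+1 then [set z0] else Z) (@tower k' i.-1)
  end.
Arguments tower : clear implicits.

Hypotheses (irZ : irreducible_set Z) (ZR : Z `<=` rep n0) (Zz0 : Z z0).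

Lemma tower_irr k i : irreducible_set (tower k i).
Proof.
elim: k i => [|k IH] i /=; first exact: irreducible_set1.
by apply: irreducible_dsum_set => //; case: i => // i; exact: irreducible_set1.
Qed.

Lemma tower_rep k i : tower k i `<=` rep (tower_dim k).
Proof.
elim: k i => [|k IH] i /=; first by move=> _ ->; exact: rep_scalar1.
move=> _ [x [y [Sx Ty ->]]]; apply: rep_dsum; last exact: IH Ty.
by case: i Sx {Ty} => [|i]; [exact: ZR | move=> ->; exact: ZR].
Qed.

Lemma tower_sub k i : tower k i.+1 `<=` tower k i.
Proof.
elim: k i => [|k IH] i //= _ [x [y [-> Ty ->]]].
exists z0, y; split=> //; first by case: i {Ty}.
by case: i Ty => [|i] //= Ty; exact: IH.
Qed.

Lemma tower_min_ord_at0 a e : min_ord_at0 a Z e -> (e < ord_at0 a z0)%N ->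
  exists m : nat -> nat -> nat, forall k i, min_ord_at0 a (tower k i) (m k i) /\
    ((i < k)%N -> (m k i < m k i.+1)%N).
Proof.
move=> Ze ez.
pose c := ord_at0 a (fun=> 1%:M : 'M[K]_r).
(* Orders add up: for [i <= k], [i] copies of [z0], [k - i] generic points of [Z], and [c] from the
   trivial summand. *)
pose m := fix m k i := if k is k'.+1 then
  ((if i is _.+1 then ord_at0 a z0 else e) + m k' i.-1)%N else c.
exists m => k i; split.
  elim: k i => [|k IH] i /=; first by split=> [_ ->|] //; exists (fun=> 1%:M).
  apply: min_ord_at0_dsum => //; case: i => // i.
  by split=> [_ ->|] //; exists z0.
elim: k i => // k IH [|i] ik /=; first by case: (k) => [|k'] /=; rewrite ltn_add2r.
by rewrite ltn_add2l; exact: IH.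
Qed.

Lemma tower_prime_chain a e k : min_ord_at0 a Z e -> (e < ord_at0 a z0)%N ->
  prime_chain (char_ring K gens (k * n0 + r)) k.
Proof.
move=> Ze ez; rewrite -tower_dimE.
have [m mP] := tower_min_ord_at0 Ze ez.
apply: (@prime_chain_sets _ _ (tower k)
  (fun i x => (char_poly (feval x a))`_(m k i))) => i ik.
  by split; [exact: tower_irr | exact: tower_rep | exact: invfun_char_poly].
have [[mi [x Sx xm]] mm] := mP k i; have [[mi' _] _] := mP k i.+1.
split; first exact: tower_sub.
  move=> y Sy; apply: coef_lt_mup0; first exact: char_poly_neq0.
  exact: leq_trans (mm ik) (mi' y Sy).
by exists x => //; rewrite -xm; apply/eqP/coef_mup0/char_poly_neq0.
Qed.

End Tower.

Lemma nonrigid_chains n0 (F : tup n0 -> K) : invfun gens F ->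
  (forall s : seq K, exists2 x, rep n0 x & F x \notin s) ->
  forall k r, prime_chain (char_ring K gens (k * n0 + r)) k.
Proof.
move=> iF Finf k r.
have [Z [irZ ZR [x [y [Zx Zy Fxy]]]]] := irreducible_subset_nonconstant iF.1 Finf.
have [a axy] : exists a, \tr (feval x a) != \tr (feval y a).
  apply: contrapT => h; move/eqP: Fxy; apply.
  suff /inv_eqP : inv_eq gens x y by apply.
  apply: trace_inv_eq => // [||a]; [exact: ZR|exact: ZR|].
  by apply/eqP/negPn/negP => axy; apply: h; exists a.
have [b bxy] := separating_ord_at0 axy.
have [e Ze] := min_ord_at0_ex b irZ.1.
(* The orders at [x] and [y] differ, so at most one of them is the minimum [e]. *)
have [z [Zz ez]] : exists z, Z z /\ (e < ord_at0 b z)%N.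
  have := Ze.1 x Zx; rewrite leq_eqVlt => /predU1P[ex|ex]; last by exists x.
  by exists y; split=> //; rewrite ltn_neqAle (Ze.1 y Zy) andbT ex.
exact: (tower_prime_chain r irZ ZR Zz k Ze ez).
Qed.

(** Take [t] in the second prime but not in the first. If its values lay in a finite [s], the
    product of the [t - c] would be 0, so some [t - c] would be in the first prime; then [c = 0]
    contradicts the choice of [t], and [c != 0] puts a unit in the second prime. *)
Lemma prime_chain_infinite_values n m : (0 < m)%N -> prime_chain (char_ring K gens n) m ->
  exists2 F : tup n -> K, invfun gens F & forall s : seq K, exists2 x, rep n x & F x \notin s.
Proof.
move=> m0 [p /(_ 0%N m0)[p01 /existsNP[t /not_implyP[tp1 tp0]]]].
have [F iF FE] := char_ring_regfun t.
exists F => // s; apply: contrapT => h.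
have cstP c : invfun gens (fun _ : tup n => c) by split=> //; exact: regfun_cst.
have /choice[cst cstE] c := regfun_char_ring (cstP c).
have prodE X : (\prod_(c <- s) (t - cst c)) X = \prod_(c <- s) (t X - c).
  elim: (s) => [|c u IH]; first by rewrite !big_nil.
  rewrite !big_cons -IH -[LHS]/((t X - cst c X) * _) cstE //.
have : \prod_(c <- s) (t - cst c) \in p 0%N.
  have -> : \prod_(c <- s) (t - cst c) = 0; last exact: rpred0.
  apply: val_inj; apply/funext => X; rewrite [LHS]prodE.
  have tX : t X \in s.
    rewrite FE; apply/negPn/negP => Fs; apply: h; exists (val X) => //.
    by apply: set_mem; exact: (valP X).
  by rewrite (big_rem _ tX) /= subrr mul0r.
have prime_prod (u : seq K) : \prod_(c <- u) (t - cst c) \in p 0%N ->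
    exists c, t - cst c \in p 0%N.
  elim: u => [|c u IH]; first by rewrite big_nil idealr1.
  by rewrite big_cons prime_idealrM => /orP[tc|/IH //]; exists c.
move=> /prime_prod[c tc].
have [c0|c0] := eqVneq c 0.
  apply: tp0; suff -> : t = t - cst c by [].
  by apply: val_inj; apply/funext => X; rewrite -[RHS]/(t X - cst c X) cstE c0 subr0.
have cp : cst c \in p 1%N by rewrite -[cst c](subKr t) rpredB ?tp1 //; exact: p01.
have := idealMr (cst c^-1) cp; suff -> : cst c^-1 * cst c = 1 by rewrite idealr1.
apply: val_inj; apply/funext => X.
by rewrite -[LHS]/(cst c^-1 X * cst c X) !cstE mulVf.
Qed.

End PrimeChains.

Theorem theorem1 (R : realType) (K : closedFieldType)
    (charK0 : [pchar K] =i pred0) (Gamma : groupType)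
    (d : nat) (gens : 'I_d -> Gamma) (gens_gen : generates gens) :
  ~ SS_rigid R K gens ->
  exists a b : R, 0 < a /\
    forall n : nat, (0 < n)%N ->
      ((a * n%:R + b)%:E <= char_dim R K gens n)%E.
Proof.
move=> /existsNP[n0 /not_implyP[n0_gt0 dim0]].
have [m [m0 chain]] : exists m, (0 < m)%N /\ prime_chain (char_ring K gens n0) m.
  apply: contrapT => h; apply: dim0; apply/eqP; rewrite eq_le; apply/andP; split.
    apply: ge_ereal_sup => _ [m mc <-]; case: m mc => // m mc.
    by case: h; exists m.+1.
  apply: ereal_sup_ubound; exists 0%N => //.
  (* Dimension at least 0 requires some prime ideal; the one of the trivial representation is
     used. *)
  pose one : 'I_d -> 'M[K]_n0 := fun=> 1%:M.
  have one_rep x : [set one]%classic x -> rep_variety gens x.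
    by move=> ->; exact: rep_scalar1.
  have [p _] := irreducible_prime (irreducible_set1 one) one_rep.
  by exists (fun=> p).
have [F iF Finf] := prime_chain_infinite_values m0 chain.
(* The constants come from [n %/ n0 > n / n0 - 1]: the chain has length [n %/ n0], and the remainder
   [n %% n0] is the degree of the trivial summand. *)
exists (n0%:R^-1), (-1); split; first by rewrite invr_gt0 ltr0n.
move=> n n_gt0; apply: le_trans (_ : ((n %/ n0)%:R%:E <= _)%E); last first.
  apply: ereal_sup_ubound; exists (n %/ n0)%N => //=.
  rewrite {1}(divn_eq n n0); exact: (nonrigid_chains gens_gen charK0 iF Finf).
rewrite lee_fin lerBlDr mulrC ler_pdivrMr ?ltr0n //.
by rewrite natr1 -natrM ler_nat ltnW // ltn_ceil.
Qed.
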